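(* Let $\mathcal I_1,\mathcal I_2$ be real intervals with $(0,0)\in\mathcal I_1\times\mathcal I_2$. Let $$G(x,t,\lambda)=-\sum_{k=0}^r\lambda^kq_k(x,t)-\sum_{s=1}^l\sum_{k=1}^{r_s}(\lambda-c_s)^{-k}q_{sk}(x,t),$$ $$F(x,t,\lambda)=-\sum_{k=0}^R\lambda^kQ_k(x,t)-\sum_{s=1}^L\sum_{k=1}^{R_s}(\lambda-C_s)^{-k}Q_{sk}(x,t)$$ with $m\times m$ matrix coefficients, be continuously differentiable in $(x,t)\in \mathcal I_1\times\mathcal I_2$ and satisfy $G_t-F_x+[G,F]=0$. Let $n>0$, let $A_1,A_2,S(0,0)$ be $n\times n$ matrices and $\Pi_1(0,0),\Pi_2(0,0)$ be $n\times m$ matrices such that $$A_1S(0,0)-S(0,0)A_2=\Pi_1(0,0)\Pi_2(0,0)^*,$$ and assume that no $c_s$ and no $C_s$ is an eigenvalue of $A_1$ or $A_2$. Let the matrix functions $\Pi_1,\Pi_2,S$ on $\mathcal I_1\times\mathcal I_2$ with these values at $(0,0)$ satisfy $$(\Pi_1)_x=\sum_{k=0}^rA_1^k\Pi_1q_k+\sum_{s=1}^l\sum_{k=1}^{r_s}(A_1-c_sI_n)^{-k}\Pi_1q_{sk},$$ $$(\Pi_2^* )_x=-\Big(\sum_{k=0}^rq_k\Pi_2^*A_2^k+\sum_{s=1}^l\sum_{k=1}^{r_s}q_{sk}\Pi_2^*(A_2-c_sI_n)^{-k}\Big),$$ $$S_x=\sum_{k=1}^r\sum_{j=1}^kA_1^{k-j}\Pi_1q_k\Pi_2^*A_2^{j-1}-\sum_{s=1}^l\sum_{k=1}^{r_s}\sum_{j=1}^k(A_1-c_sI_n)^{j-k-1}\Pi_1q_{sk}\Pi_2^*(A_2-c_sI_n)^{-j},$$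 and $$(\Pi_1)_t=\sum_{k=0}^RA_1^k\Pi_1Q_k+\sum_{s=1}^L\sum_{k=1}^{R_s}(A_1-C_sI_n)^{-k}\Pi_1Q_{sk},$$ $$(\Pi_2^* )_t=-\Big(\sum_{k=0}^RQ_k\Pi_2^*A_2^k+\sum_{s=1}^L\sum_{k=1}^{R_s}Q_{sk}\Pi_2^*(A_2-C_sI_n)^{-k}\Big),$$ $$S_t=\sum_{k=1}^R\sum_{j=1}^kA_1^{k-j}\Pi_1Q_k\Pi_2^*A_2^{j-1}-\sum_{s=1}^L\sum_{k=1}^{R_s}\sum_{j=1}^k(A_1-C_sI_n)^{j-k-1}\Pi_1Q_{sk}\Pi_2^*(A_2-C_sI_n)^{-j}.$$ Then, at the points of invertibility of $S$, the zero curvature equation $$\widetilde G_t-\widetilde F_x+[\widetilde G,\widetilde F]=0$$ holds, where $\widetilde G$ and $\widetilde F$ are the transformed matrix functions defined in the context.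
   Context: $[G,F]=GF-FG$; the zero curvature equations are identities in $\lambda$ (away from the poles); the points $c_s$ are distinct, and so are the points $C_s$. Empty sums are zero. Definition of $\widetilde G$: $$\widetilde G(x,t,\lambda)=-\Big(\sum_{k=0}^r\lambda^k\widetilde q_k+\sum_{s=1}^l\sum_{k=1}^{r_s}(\lambda-c_s)^{-k}\widetilde q_{sk}\Big),$$ $$\widetilde q_k=q_k-\sum_{j=k+1}^r\Big(q_jY_{j-k-1}-X_{j-k-1}q_j+\sum_{i=k+2}^jX_{j-i}q_jY_{i-k-2}\Big),$$ $$\widetilde q_{sk}=q_{sk}+\sum_{j=k}^{r_s}\Big(q_{sj}Y_{s,k-j-1}-X_{s,k-j-1}q_{sj}-\sum_{i=k}^jX_{s,i-j-1}q_{sj}Y_{s,k-i-1}\Big),$$ $$X_k=\Pi_2^*S^{-1}A_1^k\Pi_1,\quad Y_k=\Pi_2^*A_2^kS^{-1}\Pi_1,$$ $$X_{sk}=\Pi_2^*S^{-1}(A_1-c_sI_n)^k\Pi_1,\quad Y_{sk}=\Pi_2^*(A_2-c_sI_n)^kS^{-1}\Pi_1 .$$ $\widetilde F$ is defined by the same formulas with $r,l,r_s,c_s,q_k,q_{sk}$ replaced by $R,L,R_s,C_s,Q_k,Q_{sk}$, respectively. *)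

(* Defs.v *)
From HB Require Import structures.
From mathcomp Require Import all_boot all_order all_algebra.
From mathcomp Require Import all_classical all_reals all_analysis.
From mathcomp Require Import complex.

Set Implicit Arguments.
Unset Strict Implicit.
Unset Printing Implicit Defensive.

Import Order.TTheory GRing.Theory Num.Theory.
Import numFieldNormedType.Exports.

Local Open Scope classical_set_scope.
Local Open Scope ring_scope.
Local Open Scope complex_scope.

(* [f] takes values in a complex space but has a real argument.  The limit is
   taken inside [I], hence it is one-sided at an endpoint belonging to [I]. *)
Definition is_derivative_in (R : realType) (V : normedModType R[i])
    (I : interval R) (f : R -> V) (x : R) (f' : V) : Prop :=
  (fun y : R => ((y - x)%:C)^-1 *: (f y - f x)) @ within [set` I] x^' --> f'.

(* A one-point interval would make [is_derivative_in] vacuous. *)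
Definition nondegenerate_interval (R : realType) (I : interval R) : Prop :=
  exists x y : R, [/\ x \in I, y \in I & x < y].

Definition continuously_differentiable_on (R : realType)
    (V : normedModType R[i]) (I1 I2 : interval R) (f : R -> R -> V) : Prop :=
  exists fx ft : R -> R -> V,
    [/\ forall x t, x \in I1 -> t \in I2 ->
          is_derivative_in I1 (fun x' => f x' t) x (fx x t),
        forall x t, x \in I1 -> t \in I2 ->
          is_derivative_in I2 (fun t' => f x t') t (ft x t),
        {within [set` I1] `*` [set` I2],
          continuous (fun p : R * R => fx p.1 p.2)} &
        {within [set` I1] `*` [set` I2],
          continuous (fun p : R * R => ft p.1 p.2)}].

Definition commutator (C : fieldType) (m : nat) (G F : 'M[C]_m) : 'M[C]_m :=
  G *m F - F *m G.

Definition zero_curvature_at (R : realType) (m : nat) (I1 I2 : interval R)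
    (G F : R -> R -> R[i] -> 'M[R[i]]_m) (x t : R) (lam : R[i]) : Prop :=
  exists Gt Fx : 'M[R[i]]_m,
    [/\ is_derivative_in I2 (fun t' => G x t' lam) t Gt,
        is_derivative_in I1 (fun x' => F x' t lam) x Fx &
        Gt - Fx + commutator (G x t lam) (F x t lam) = 0].

(* Throughout, [r], [rs], [c], [q], [qs] stand for r, r_s, c_s, q_k, q_{sk};
   only the [q k] with k <= r and the [qs s k] with 1 <= k <= r_s are used. *)
Definition rational_mx (C : fieldType) (m r l : nat) (rs : 'I_l -> nat)
    (c : 'I_l -> C) (q : nat -> 'M[C]_m) (qs : 'I_l -> nat -> 'M[C]_m)
    (lam : C) : 'M[C]_m :=
  - (\sum_(0 <= k < r.+1) lam ^+ k *: q k)
  - \sum_(s < l) \sum_(1 <= k < (rs s).+1) (lam - c s) ^- k *: qs s k.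

(* In what follows, [P1], [P2s], [S] are the values of Pi_1, of the adjoint
   Pi_2^*, and of S; the three [rhs] functions are the right-hand sides of the
   linear system for Pi_1, Pi_2^* and S. *)
Definition rhs_Pi1 (C : fieldType) (m n r l : nat) (rs : 'I_l -> nat)
    (c : 'I_l -> C) (q : nat -> 'M[C]_m) (qs : 'I_l -> nat -> 'M[C]_m)
    (A1 : 'M[C]_n.+1) (P1 : 'M[C]_(n.+1, m)) : 'M[C]_(n.+1, m) :=
  \sum_(0 <= k < r.+1) A1 ^+ k *m P1 *m q k
  + \sum_(s < l) \sum_(1 <= k < (rs s).+1)
      (A1 - (c s)%:M) ^- k *m P1 *m qs s k.

Definition rhs_Pi2s (C : fieldType) (m n r l : nat) (rs : 'I_l -> nat)
    (c : 'I_l -> C) (q : nat -> 'M[C]_m) (qs : 'I_l -> nat -> 'M[C]_m)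
    (A2 : 'M[C]_n.+1) (P2s : 'M[C]_(m, n.+1)) : 'M[C]_(m, n.+1) :=
  - (\sum_(0 <= k < r.+1) q k *m P2s *m A2 ^+ k
     + \sum_(s < l) \sum_(1 <= k < (rs s).+1)
         qs s k *m P2s *m (A2 - (c s)%:M) ^- k).

Definition rhs_S (C : fieldType) (m n r l : nat) (rs : 'I_l -> nat)
    (c : 'I_l -> C) (q : nat -> 'M[C]_m) (qs : 'I_l -> nat -> 'M[C]_m)
    (A1 A2 : 'M[C]_n.+1) (P1 : 'M[C]_(n.+1, m)) (P2s : 'M[C]_(m, n.+1)) :
    'M[C]_n.+1 :=
  \sum_(1 <= k < r.+1) \sum_(1 <= j < k.+1)
    A1 ^+ (k - j) *m P1 *m q k *m P2s *m A2 ^+ (j - 1)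
  - \sum_(s < l) \sum_(1 <= k < (rs s).+1) \sum_(1 <= j < k.+1)
      (A1 - (c s)%:M) ^ (j%:Z - k%:Z - 1) *m P1 *m qs s k *m P2s
        *m (A2 - (c s)%:M) ^- j.

(* [X_mx A1 P1 P2s S k] is X_k, and [X_mx (A1 - (c s)%:M) P1 P2s S k] is X_{sk};
   similarly for [Y_mx]. *)
Definition X_mx (C : fieldType) (m n : nat) (A1 : 'M[C]_n.+1)
    (P1 : 'M[C]_(n.+1, m)) (P2s : 'M[C]_(m, n.+1)) (S : 'M[C]_n.+1)
    (k : int) : 'M[C]_m :=
  P2s *m S^-1 *m A1 ^ k *m P1.

Definition Y_mx (C : fieldType) (m n : nat) (A2 : 'M[C]_n.+1)
    (P1 : 'M[C]_(n.+1, m)) (P2s : 'M[C]_(m, n.+1)) (S : 'M[C]_n.+1)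
    (k : int) : 'M[C]_m :=
  P2s *m A2 ^ k *m S^-1 *m P1.

Definition q_tilde (C : fieldType) (m n r : nat) (q : nat -> 'M[C]_m)
    (A1 A2 : 'M[C]_n.+1) (P1 : 'M[C]_(n.+1, m)) (P2s : 'M[C]_(m, n.+1))
    (S : 'M[C]_n.+1) (k : nat) : 'M[C]_m :=
  let X := X_mx A1 P1 P2s S in
  let Y := Y_mx A2 P1 P2s S in
  q k - \sum_(k.+1 <= j < r.+1)
    (q j *m Y (j%:Z - k%:Z - 1) - X (j%:Z - k%:Z - 1) *m q j
     + \sum_(k.+2 <= i < j.+1)
         X (j%:Z - i%:Z) *m q j *m Y (i%:Z - k%:Z - 2)).

Definition qs_tilde (C : fieldType) (m n l : nat) (rs : 'I_l -> nat)
    (c : 'I_l -> C) (qs : 'I_l -> nat -> 'M[C]_m)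
    (A1 A2 : 'M[C]_n.+1) (P1 : 'M[C]_(n.+1, m)) (P2s : 'M[C]_(m, n.+1))
    (S : 'M[C]_n.+1) (s : 'I_l) (k : nat) : 'M[C]_m :=
  let X := X_mx (A1 - (c s)%:M) P1 P2s S in
  let Y := Y_mx (A2 - (c s)%:M) P1 P2s S in
  qs s k + \sum_(k <= j < (rs s).+1)
    (qs s j *m Y (k%:Z - j%:Z - 1) - X (k%:Z - j%:Z - 1) *m qs s j
     - \sum_(k <= i < j.+1)
         X (i%:Z - j%:Z - 1) *m qs s j *m Y (k%:Z - i%:Z - 1)).

Definition rational_mx_tilde (C : fieldType) (m n r l : nat)
    (rs : 'I_l -> nat) (c : 'I_l -> C) (q : nat -> 'M[C]_m)
    (qs : 'I_l -> nat -> 'M[C]_m)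
    (A1 A2 : 'M[C]_n.+1) (P1 : 'M[C]_(n.+1, m)) (P2s : 'M[C]_(m, n.+1))
    (S : 'M[C]_n.+1) (lam : C) : 'M[C]_m :=
  - (\sum_(0 <= k < r.+1) lam ^+ k *: q_tilde r q A1 A2 P1 P2s S k
     + \sum_(s < l) \sum_(1 <= k < (rs s).+1)
         (lam - c s) ^- k *: qs_tilde rs c qs A1 A2 P1 P2s S s k).

(* Main.v *)
(* Put U = Pi_2^* S^-1, R_j = (A_j - lambda)^-1 and w = 1 - U R_1 Pi_1 (the
   Darboux matrix).  The identity A_1 S - S A_2 = Pi_1 Pi_2^*, which the linear
   system preserves, makes w invertible with w^-1 = 1 + Pi_2^* R_2 S^-1 Pi_1, and
   summing geometric progressions gives w_x = Gtilde w - w G and, likewise,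
   w_t = Ftilde w - w F.  Together with the zero curvature equation for G, F this
   turns E = Gtilde_t - Ftilde_x + [Gtilde, Ftilde] into (w_xt - w_tx) w^-1.

   Equality of the mixed derivatives is never needed.  By the Leibniz rule
   w_xt - w_tx = K R_1 Pi_1 + U R_1 M with K, M independent of lambda, so E is a
   rational function of lambda which vanishes at infinity and whose poles are
   eigenvalues of A_1 or A_2.  By construction its poles are also among the c_s
   and C_s, which are not eigenvalues; hence E = 0. *)
Require Import Defs.
From HB Require Import structures.
From mathcomp Require Import all_boot all_order all_algebra.
From mathcomp Require Import all_classical all_reals all_analysis.
From mathcomp Require Import complex.
From mathcomp Require Import zify ring lra.

Set Implicit Arguments.
Unset Strict Implicit.
Unset Printing Implicit Defensive.

Import Order.TTheory GRing.Theory Num.Theory.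
Import numFieldNormedType.Exports.

Local Open Scope ring_scope.

(** * The transformed coefficients and the Darboux matrix *)

(** Comparing w_xt with w_tx means differentiating the x-identity for w in t and conversely, so the
    right-hand sides of the x-system must be differentiable in t. They contain the individual q_k
    and q_{sk}, whereas the assumptions only speak of G at each fixed lambda. The bridge is the
    linear independence of the powers of lambda and of 1/(lambda - c_s): each coefficient is a
    linear combination of values of G at finitely many lambda, with nodes and weights that depend on
    r, r_s, c_s alone, hence not on (x,t). This also makes Gtilde_t rational in lambda with poles at
    most at the c_s, which is what confines the poles of E. *)

Lemma big_triangle_ltn (V : nmodType) (n : nat) (F : nat -> nat -> V) :
  \sum_(0 <= k < n) \sum_(k.+1 <= j < n) F k j
  = \sum_(0 <= j < n) \sum_(0 <= k < j) F k j.
Proof.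
elim: n => [|n IH]; first by rewrite !big_geq.
rewrite [LHS]big_nat_recr // [RHS]big_nat_recr //= -IH [\sum_(n.+1 <= j < n.+1) _]big_geq //.
rewrite addr0 -big_split.
by apply: eq_big_nat => k kn; rewrite big_nat_recr.
Qed.

Lemma big_triangle_leq (V : nmodType) (n : nat) (F : nat -> nat -> V) :
  \sum_(1 <= k < n.+1) \sum_(k <= j < n.+1) F k j
  = \sum_(1 <= j < n.+1) \sum_(1 <= k < j.+1) F k j.
Proof.
elim: n => [|n IH]; first by rewrite !big_geq.
rewrite [LHS]big_nat_recr // [RHS]big_nat_recr //= -IH big_nat1.
rewrite [\sum_(1 <= k < n.+2) _]big_nat_recr // addrA; congr (_ + _).
rewrite -big_split; apply: eq_big_nat => k kn /=.
by rewrite big_nat_recr //=; lia.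
Qed.

Lemma geometric_sum_mx (C : comNzRingType) (n : nat) (B : 'M[C]_n.+1) (mu : C) (j : nat) :
  (\sum_(0 <= k < j) mu ^+ k *: B ^+ (j - k - 1)) * (B - mu%:M)
  = B ^+ j - (mu ^+ j)%:M.
Proof.
have cB : GRing.comm B mu%:M by exact: comm_mx_scalar.
rewrite (_ : (mu ^+ j)%:M = mu%:M ^+ j); last by rewrite -rmorphXn.
rewrite subrXX_comm // big_mkord mulr_suml mulr_sumr.
apply: eq_bigr => i _.
have scal b (M : 'M[C]_n.+1) : M * b%:M = b *: M by exact: mul_mx_scalar.
rewrite (_ : j - i - 1 = j.-1 - i)%N; last by lia.
rewrite -[mu%:M ^+ i]rmorphXn /= scal -scalerAl -scalerAr; congr (_ *: _).
by apply/commr_sym/commrX/commr_sym/commrB => //; apply: commr_refl.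
Qed.

(** This is [geometric_sum_mx] at [B^-1] and [mu^-1]: since B^-1 - mu^-1 = - mu^-1 B^-1 (B - mu),
    the extra factors raise both negative exponents by one and flip the sign. *)
Lemma geometric_sumV_mx (C : fieldType) (n : nat) (B : 'M[C]_n.+1) (mu : C) (j : nat) :
  mu != 0 -> B \is a GRing.unit ->
  (\sum_(1 <= k < j.+1) mu ^- k *: B ^- (j.+1 - k)) * (B - mu%:M)
  = (mu ^- j)%:M - B ^- j.
Proof.
move=> mu0 uB.
have scal b (M : 'M[C]_n.+1) : M * b%:M = b *: M by exact: mul_mx_scalar.
have := geometric_sum_mx B^-1 mu^-1 j; rewrite !exprVn => /(congr1 -%R).
rewrite opprB => <-; rewrite big_add1 /= mulr_suml mulr_suml -sumrN.
apply: eq_big_nat => k /andP[_ kj].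
rewrite -!scalerAl -scalerN -!exprVn exprSr -scalerA; congr (_ *: _).
rewrite -mulrN opprB !mulrBr !scal scalerBr scalerA mulVf // scale1r.
rewrite (_ : j.+1 - k.+1 = (j - k - 1).+1)%N; last by lia.
by rewrite exprSr mulrVK // scalerBr; congr (_ - _); rewrite ?scalerA ?mulVf ?scale1r.
Qed.

Lemma mx_entryE (C : comNzRingType) (m n : nat) :
  (forall (A B : 'M[C]_(m, n)) i j, (A + B) i j = A i j + B i j) *
  (forall (A : 'M[C]_(m, n)) i j, (- A) i j = - A i j) *
  (forall a (A : 'M[C]_(m, n)) i j, (a *: A) i j = a * A i j) *
  (forall i j, (0 : 'M[C]_(m, n)) i j = 0).
Proof. by do ![split] => *; rewrite mxE. Qed.

(* Linear identities between matrices are checked entrywise, so that [ring]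
   treats each noncommutative monomial as an atom. *)
Ltac mx_linear := apply/matrixP => ? ?; rewrite !mx_entryE; ring.

Section Dressing.
Variables (C : fieldType) (m n : nat).
Variables (U : 'M[C]_(m, n.+1)) (V : 'M[C]_(n.+1, m)).
Variables (P1 : 'M[C]_(n.+1, m)) (P2s : 'M[C]_(m, n.+1)).

(* [dress R1 R2 g p1 p2 s] is [w g w^-1 - w_x w^-1], where
   [w = 1 - U R1 P1] is the Darboux matrix and [p1], [- p2], [s] are the
   derivatives of [P1], [P2s], [S]. *)
Definition dress (R1 R2 : 'M[C]_n.+1) (g : 'M[C]_m) (p1 : 'M[C]_(n.+1, m))
    (p2 : 'M[C]_(m, n.+1)) (s : 'M[C]_n.+1) : 'M[C]_m :=
  (1%:M - U *m R1 *m P1) *m g *m (1%:M + P2s *m R2 *m V)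
  + U *m R1 *m p1 *m (1%:M + P2s *m R2 *m V) - (p2 + U *m s) *m R2 *m V.

(** Joint additivity in [(g, p1, p2, s)] allows Gtilde to be computed one monomial of G at a time,
    each monomial carrying its own share of the linear system. *)
Lemma dressD R1 R2 g p1 p2 s g' p1' p2' s' :
  dress R1 R2 (g + g') (p1 + p1') (p2 + p2') (s + s')
  = dress R1 R2 g p1 p2 s + dress R1 R2 g' p1' p2' s'.
Proof. by rewrite /dress !(mulmxDr, mulmxDl); mx_linear. Qed.

Lemma dress0 R1 R2 : dress R1 R2 0 0 0 0 = 0.
Proof. by rewrite /dress !(mulmx0, mul0mx, addr0, subr0). Qed.

Lemma dress_sum R1 R2 (I : Type) (e : seq I) (P : pred I) g p1 p2 s :
  dress R1 R2 (\sum_(i <- e | P i) g i) (\sum_(i <- e | P i) p1 i)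
    (\sum_(i <- e | P i) p2 i) (\sum_(i <- e | P i) s i)
  = \sum_(i <- e | P i) dress R1 R2 (g i) (p1 i) (p2 i) (s i).
Proof.
elim: e => [|i e IH]; first by rewrite !big_nil dress0.
by rewrite !big_cons; case: (P i); rewrite ?dressD IH.
Qed.

Variables (B1 B2 : 'M[C]_n.+1) (mu : C).
Hypothesis uB1 : B1 - mu%:M \is a GRing.unit.
Hypothesis uB2 : B2 - mu%:M \is a GRing.unit.

(** A formal identity in [U], [V], [P1], [P2s]. The geometric sums [K1] and [K2] turn the single
    sums into differences of j-th powers times a resolvent. In the double sum, summing over [k]
    first leaves [K2 i]; its two terms give the [s] term of [dress] and a product containing
    [K1 j]. *)
Lemma dress_monomial (j : nat) (q : 'M[C]_m) :
  mu ^+ j *: q - \sum_(0 <= k < j) mu ^+ k *: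
    (q *m (P2s *m B2 ^+ (j - k - 1) *m V) - U *m B1 ^+ (j - k - 1) *m P1 *m q
     + \sum_(k.+2 <= i < j.+1)
         U *m B1 ^+ (j - i) *m P1 *m q *m (P2s *m B2 ^+ (i - k - 2) *m V))
  = dress (B1 - mu%:M)^-1 (B2 - mu%:M)^-1 (mu ^+ j *: q)
      (B1 ^+ j *m P1 *m q) (q *m P2s *m B2 ^+ j)
      (\sum_(1 <= i < j.+1) B1 ^+ (j - i) *m P1 *m q *m P2s *m B2 ^+ (i - 1)).
Proof.
set R1 := _^-1; set R2 := _^-1.
pose K1 i := \sum_(0 <= k < i) mu ^+ k *: B1 ^+ (i - k - 1).
pose K2 i := \sum_(0 <= k < i) mu ^+ k *: B2 ^+ (i - k - 1).
have K2E i : K2 i = B2 ^+ i *m R2 - mu ^+ i *: R2.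
  rewrite -mul_scalar_mx -mulmxBl -geometric_sum_mx mulmxE -mulrA mulrV //.
  by rewrite mulr1.
have K1E : K1 j = R1 *m B1 ^+ j - mu ^+ j *: R1.
  rewrite -mul_mx_scalar -mulmxBr -geometric_sum_mx mulmxE.
  have c1 : GRing.comm (K1 j) (B1 - mu%:M).
    apply: commrB; last by apply: comm_mx_scalar.
    apply/commr_sym/commr_sum => k _; rewrite /GRing.comm -scalerAr -scalerAl.
    by congr (_ *: _); exact: (commrX _ (commr_refl B1)).
  by rewrite [_ * (_ - _)]c1 mulrA mulVr // mul1r.
have double : \sum_(0 <= k < j) mu ^+ k *: (\sum_(k.+2 <= i < j.+1)
     U *m B1 ^+ (j - i) *m P1 *m q *m (P2s *m B2 ^+ (i - k - 2) *m V))
  = \sum_(0 <= i < j) U *m B1 ^+ (j - i - 1) *m P1 *m q *m P2s *m K2 i *m V.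
  transitivity (\sum_(0 <= k < j) \sum_(k.+1 <= i < j) mu ^+ k *:
     (U *m B1 ^+ (j - i - 1) *m P1 *m q *m (P2s *m B2 ^+ (i - k - 1) *m V))).
    apply: eq_big_nat => k kj; rewrite scaler_sumr big_add1.
    apply: eq_big_nat => i ki; rewrite (_ : j - i.+1 = j - i - 1)%N; last by lia.
    by rewrite (_ : i.+1 - k - 2 = i - k - 1)%N; last by lia.
  rewrite big_triangle_ltn; apply: eq_big_nat => i ij.
  rewrite /K2 mulmx_sumr mulmx_suml; apply: eq_big_nat => k ki.
  by rewrite -!scalemxAr -!scalemxAl ?mulmxA.
have single2 : \sum_(0 <= k < j) mu ^+ k *: (q *m (P2s *m B2 ^+ (j - k - 1) *m V))
  = q *m P2s *m K2 j *m V.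
  rewrite /K2 mulmx_sumr mulmx_suml; apply: eq_big_nat => k ki.
  by rewrite -!scalemxAr -!scalemxAl ?mulmxA.
have single1 : \sum_(0 <= k < j) mu ^+ k *: (U *m B1 ^+ (j - k - 1) *m P1 *m q)
  = U *m K1 j *m P1 *m q.
  rewrite /K1 mulmx_sumr !mulmx_suml; apply: eq_big_nat => k ki.
  by rewrite -!scalemxAr -!scalemxAl ?mulmxA.
pose s := \sum_(0 <= i < j) B1 ^+ (j - i - 1) *m P1 *m q *m P2s *m B2 ^+ i.
have sE : \sum_(0 <= i < j) U *m B1 ^+ (j - i - 1) *m P1 *m q *m P2s *m K2 i *m V
   = U *m s *m R2 *m V - U *m K1 j *m P1 *m q *m P2s *m R2 *m V.
  rewrite /s /K1 !(mulmx_sumr, mulmx_suml) -sumrB; apply: eq_big_nat => i ij.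
  by rewrite K2E mulmxBr mulmxBl -!scalemxAr -!scalemxAl ?mulmxA.
have -> : \sum_(1 <= i < j.+1) B1 ^+ (j - i) *m P1 *m q *m P2s *m B2 ^+ (i - 1) = s.
  by rewrite big_add1; apply: eq_big_nat => i ij; rewrite subn1 /= subnS -subn1.
under eq_bigr do rewrite scalerDr scalerBr.
rewrite big_split sumrB /= double sE single1 single2 K1E K2E /dress.
rewrite !(mulmxDr, mulmxDl, mulmxBl, mulmxBr, mulmx1, mul1mx, mulNmx, mulmxN).
by rewrite -?scalemxAr -?scalemxAl ?mulmxA; mx_linear.
Qed.

(** Intended for [B1 = A1 - c_s], [B2 = A2 - c_s] and [mu = lam - c_s]: the shifts cancel in
    [B1 - mu] and [B2 - mu], so the polar parts involve the same resolvents at [lam] as the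
    polynomial part. *)
Lemma dress_monomialV (j : nat) (q : 'M[C]_m) :
  mu != 0 -> B1 \is a GRing.unit -> B2 \is a GRing.unit ->
  mu ^- j *: q + \sum_(1 <= k < j.+1) mu ^- k *:
    (q *m (P2s *m B2 ^- (j.+1 - k) *m V) - U *m B1 ^- (j.+1 - k) *m P1 *m q
     - \sum_(k <= i < j.+1)
         U *m B1 ^- (j.+1 - i) *m P1 *m q *m (P2s *m B2 ^- (i.+1 - k) *m V))
  = dress (B1 - mu%:M)^-1 (B2 - mu%:M)^-1 (mu ^- j *: q)
      (B1 ^- j *m P1 *m q) (q *m P2s *m B2 ^- j)
      (- \sum_(1 <= i < j.+1)
           B1 ^- (j.+1 - i) *m P1 *m q *m P2s *m B2 ^- i).
Proof.
move=> mu0 B1u B2u; set R1 := (B1 - _)^-1; set R2 := (B2 - _)^-1.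
pose K1 i := \sum_(1 <= k < i.+1) mu ^- k *: B1 ^- (i.+1 - k).
pose K2 i := \sum_(1 <= k < i.+1) mu ^- k *: B2 ^- (i.+1 - k).
have K2E i : K2 i = mu ^- i *: R2 - B2 ^- i *m R2.
  rewrite -mul_scalar_mx -mulmxBl -geometric_sumV_mx // mulmxE -mulrA mulrV //.
  by rewrite mulr1.
have K1E : K1 j = mu ^- j *: R1 - R1 *m B1 ^- j.
  rewrite -mul_mx_scalar -mulmxBr -geometric_sumV_mx // mulmxE.
  have c1 : GRing.comm (K1 j) (B1 - mu%:M).
    apply: commrB; last by apply: comm_mx_scalar.
    apply/commr_sym/commr_sum => k _; rewrite /GRing.comm -scalerAr -scalerAl.
    by congr (_ *: _); exact: (commrV (commrX _ (commr_refl B1))).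
  by rewrite [_ * (_ - _)]c1 mulrA mulVr // mul1r.
have double : \sum_(1 <= k < j.+1) mu ^- k *: (\sum_(k <= i < j.+1)
     U *m B1 ^- (j.+1 - i) *m P1 *m q *m (P2s *m B2 ^- (i.+1 - k) *m V))
  = \sum_(1 <= i < j.+1)
      U *m B1 ^- (j.+1 - i) *m P1 *m q *m P2s *m K2 i *m V.
  under eq_bigr do rewrite scaler_sumr.
  rewrite big_triangle_leq; apply: eq_big_nat => i ij.
  rewrite /K2 mulmx_sumr mulmx_suml; apply: eq_big_nat => k ki.
  by rewrite -!scalemxAr -!scalemxAl ?mulmxA.
have single2 : \sum_(1 <= k < j.+1)
    mu ^- k *: (q *m (P2s *m B2 ^- (j.+1 - k) *m V)) = q *m P2s *m K2 j *m V.
  rewrite /K2 mulmx_sumr mulmx_suml; apply: eq_big_nat => k ki.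
  by rewrite -!scalemxAr -!scalemxAl ?mulmxA.
have single1 : \sum_(1 <= k < j.+1)
    mu ^- k *: (U *m B1 ^- (j.+1 - k) *m P1 *m q) = U *m K1 j *m P1 *m q.
  rewrite /K1 mulmx_sumr !mulmx_suml; apply: eq_big_nat => k ki.
  by rewrite -!scalemxAr -!scalemxAl ?mulmxA.
set s := \sum_(1 <= i < _) B1 ^- _ *m _ *m _ *m _ *m _.
have sE : \sum_(1 <= i < j.+1)
     U *m B1 ^- (j.+1 - i) *m P1 *m q *m P2s *m K2 i *m V
   = U *m K1 j *m P1 *m q *m P2s *m R2 *m V - U *m s *m R2 *m V.
  rewrite /s /K1 !(mulmx_sumr, mulmx_suml) -sumrB; apply: eq_big_nat => i ij.
  by rewrite K2E mulmxBr mulmxBl -!scalemxAr -!scalemxAl ?mulmxA.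
under eq_bigr do rewrite !scalerBr.
rewrite !sumrB /= double sE single1 single2 K1E K2E /dress.
rewrite !(mulmxDr, mulmxDl, mulmxBl, mulmxBr, mulmx1, mul1mx, mulNmx, mulmxN).
by rewrite -?scalemxAr -?scalemxAl ?mulmxA; mx_linear.
Qed.
End Dressing.

Lemma dressN (C : fieldType) (m n : nat) (U : 'M[C]_(m, n.+1)) V P1 P2s R1 R2
    g p1 p2 s :
  dress U V P1 P2s R1 R2 (- g) (- p1) (- p2) (- s)
  = - dress U V P1 P2s R1 R2 g p1 p2 s.
Proof.
apply/eqP; rewrite -addr_eq0 -dressD.
by apply/eqP; rewrite !addNr dress0.
Qed.

(** The arguments of [dress] are minus the derivatives prescribed by the linear system, so the
    right-hand side stands for w G w^-1 + w_x w^-1. The overall minus sign of G is pulled out before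
    the reduction to monomials. *)
Lemma rational_mx_tilde_dress (C : fieldType) (m n r l : nat)
    (rs : 'I_l -> nat) (c : 'I_l -> C) (q : nat -> 'M[C]_m)
    (qs : 'I_l -> nat -> 'M[C]_m) (A1 A2 : 'M[C]_n.+1)
    (P1 : 'M[C]_(n.+1, m)) (P2s : 'M[C]_(m, n.+1)) (S : 'M[C]_n.+1) (lam : C) :
  (forall s, lam != c s) ->
  (forall s, A1 - (c s)%:M \is a GRing.unit) ->
  (forall s, A2 - (c s)%:M \is a GRing.unit) ->
  A1 - lam%:M \is a GRing.unit -> A2 - lam%:M \is a GRing.unit ->
  rational_mx_tilde r rs c q qs A1 A2 P1 P2s S lam
  = dress (P2s *m S^-1) (S^-1 *m P1) P1 P2s (A1 - lam%:M)^-1 (A2 - lam%:M)^-1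
      (rational_mx r rs c q qs lam) (- rhs_Pi1 r rs c q qs A1 P1)
      (rhs_Pi2s r rs c q qs A2 P2s) (- rhs_S r rs c q qs A1 A2 P1 P2s).
Proof.
move=> lamc uc1 uc2 u1 u2; rewrite /rational_mx -opprD dressN dressD.
congr (- (_ + _)).
  (* The term [k = 0] has an empty inner sum; adding it gives the four sums the common range that
     [dress_sum] requires. *)
  have -> : \sum_(1 <= k < r.+1) \sum_(1 <= j < k.+1)
      A1 ^+ (k - j) *m P1 *m q k *m P2s *m A2 ^+ (j - 1)
    = \sum_(0 <= k < r.+1) \sum_(1 <= j < k.+1)
      A1 ^+ (k - j) *m P1 *m q k *m P2s *m A2 ^+ (j - 1).
    by rewrite [RHS]big_ltn // [X in _ = X + _]big_geq // add0r.
  rewrite dress_sum /q_tilde.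
  under eq_bigr do rewrite scalerBr scaler_sumr.
  (* Grouping by [j], the power of G from which a term comes, instead of [k], the power of Gtilde to
     which it contributes, isolates one monomial of G. *)
  rewrite sumrB big_triangle_ltn -sumrB; apply: eq_big_nat => j jr.
  rewrite -dress_monomial //; congr (_ - _).
  apply: eq_big_nat => k kj; rewrite /X_mx /Y_mx.
  rewrite (_ : j%:Z - k%:Z - 1 = (j - k - 1)%N); last by lia.
  congr (_ *: (_ - _ + _)); first by rewrite !mulmxA.
  apply: eq_big_nat => i ki.
  rewrite (_ : j%:Z - i%:Z = (j - i)%N); last by lia.
  rewrite (_ : i%:Z - k%:Z - 2 = (i - k - 2)%N); last by lia.
  by rewrite -!exprnP !mulmxA.
rewrite -sumrN dress_sum; apply: eq_bigr => s _.
rewrite -sumrN dress_sum /qs_tilde.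
under eq_bigr do rewrite scalerDr scaler_sumr.
rewrite big_split /= big_triangle_leq -big_split; apply: eq_big_nat => j jr.
have e A : A - lam%:M = (A - (c s)%:M) - (lam - c s)%:M :> 'M[C]_n.+1.
  by rewrite raddfB /= opprB addrA subrK.
have {}lamc : lam - c s != 0 by rewrite subr_eq0.
have neg (M : 'M[C]_n.+1) (a b : nat) : (a <= b)%N ->
    M ^ (a%:Z - b%:Z - 1) = M ^- (b.+1 - a).
  by move=> ab; rewrite (_ : _ - 1 = - (b.+1 - a)%N%:Z) ?exprnN //; lia.
rewrite e (e A2) in u1 u2 *.
rewrite [X in dress _ _ _ _ _ _ _ _ _ (- X)](@eq_big_nat _ _ _ _ _ _
  (fun i => (A1 - (c s)%:M) ^- (j.+1 - i) *m P1 *m qs s j *m P2s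
            *m (A2 - (c s)%:M) ^- i)); last by move=> i ij; rewrite neg //; lia.
rewrite -dress_monomialV //; congr (_ + _).
apply: eq_big_nat => k kj; rewrite /X_mx /Y_mx neg; last by lia.
rewrite neg; last by lia.
congr (_ *: (_ - _ - _)); first by rewrite !mulmxA.
apply: eq_big_nat => i ki; rewrite neg; last by lia.
by rewrite neg ?mulmxA; last by lia.
Qed.

(** The operator Z -> A1 Z - Z A2 sends the j-th summand to a difference of two consecutive terms
    A1^(k-j) M A2^j. *)
Lemma sylvester_telescope (C : comNzRingType) (n k : nat) (A1 A2 M : 'M[C]_n.+1) :
  A1 *m (\sum_(1 <= j < k.+1) A1 ^+ (k - j) *m M *m A2 ^+ (j - 1))
  - (\sum_(1 <= j < k.+1) A1 ^+ (k - j) *m M *m A2 ^+ (j - 1)) *m A2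
  = A1 ^+ k *m M - M *m A2 ^+ k.
Proof.
rewrite mulmx_sumr mulmx_suml -sumrB big_add1 /=.
have := telescope_sumr (fun j => A1 ^+ (k - j) *m M *m A2 ^+ j) (leq0n k).
rewrite subnn subn0 expr0 mul1mx expr0 mulmx1 => /(congr1 -%R).
rewrite opprB => <-; rewrite -sumrN; apply: eq_big_nat => j jk.
have e : A2 ^+ j *m A2 = A2 ^+ j.+1 by rewrite exprSr.
have e' : A1 *m A1 ^+ (k - j.+1) = A1 ^+ (k - j) by rewrite -[(k - j)%N]subnSK ?exprS //; lia.
by rewrite opprB subn1 /= -(mulmxA _ _ A2) e !mulmxA e'.
Qed.

Lemma sylvester_telescopeV (C : fieldType) (n k : nat) (B1 B2 M : 'M[C]_n.+1) :
  B1 \is a GRing.unit -> B2 \is a GRing.unit ->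
  B1 *m (\sum_(1 <= j < k.+1) B1 ^- (k.+1 - j) *m M *m B2 ^- j)
  - (\sum_(1 <= j < k.+1) B1 ^- (k.+1 - j) *m M *m B2 ^- j) *m B2
  = M *m B2 ^- k - B1 ^- k *m M.
Proof.
move=> u1 u2; rewrite mulmx_sumr mulmx_suml -sumrB big_add1 /=.
have := telescope_sumr (fun j => B1 ^- (k - j) *m M *m B2 ^- j) (leq0n k).
rewrite subnn subn0 !expr0 !invr1 mul1mx mulmx1 => <-.
apply: eq_big_nat => j jk; rewrite -!exprVn subSS.
have e : B2^-1 ^+ j.+1 *m B2 = B2^-1 ^+ j by rewrite exprSr; exact: mulrVK.
have e' : B1 *m B1^-1 ^+ (k - j) = B1^-1 ^+ (k - j.+1).
  by rewrite -[(k - j)%N]subnSK; [rewrite exprS; exact: mulVKr | lia].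
by rewrite -(mulmxA _ _ B2) e !mulmxA e'.
Qed.

(** Infinitesimal form of the conservation law: along the linear system, A1 S - S A2 and Pi_1 Pi_2^*
    have the same derivative. *)
Lemma rhs_sylvester (C : fieldType) (m n r l : nat)
    (rs : 'I_l -> nat) (c : 'I_l -> C) (q : nat -> 'M[C]_m)
    (qs : 'I_l -> nat -> 'M[C]_m) (A1 A2 : 'M[C]_n.+1)
    (P1 : 'M[C]_(n.+1, m)) (P2s : 'M[C]_(m, n.+1)) :
  (forall s, A1 - (c s)%:M \is a GRing.unit) ->
  (forall s, A2 - (c s)%:M \is a GRing.unit) ->
  A1 *m rhs_S r rs c q qs A1 A2 P1 P2s - rhs_S r rs c q qs A1 A2 P1 P2s *m A2
  = rhs_Pi1 r rs c q qs A1 P1 *m P2s + P1 *m rhs_Pi2s r rs c q qs A2 P2s.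
Proof.
move=> u1 u2; rewrite /rhs_S /rhs_Pi1 /rhs_Pi2s.
set pos := \sum_(1 <= k < r.+1) _.
set neg := \sum_s \sum_(1 <= k < _) \sum_(1 <= j < _) _.
have posE : A1 *m pos - pos *m A2
    = (\sum_(0 <= k < r.+1) A1 ^+ k *m P1 *m q k) *m P2s
      - P1 *m (\sum_(0 <= k < r.+1) q k *m P2s *m A2 ^+ k).
  have -> : pos = \sum_(0 <= k < r.+1) \sum_(1 <= j < k.+1)
      A1 ^+ (k - j) *m (P1 *m q k *m P2s) *m A2 ^+ (j - 1).
    rewrite [RHS]big_ltn // [X in _ = X + _]big_geq // add0r.
    by do 2!apply: eq_bigr => ? _; rewrite !mulmxA.
  rewrite !(mulmx_sumr, mulmx_suml) -!sumrB; apply: eq_bigr => k _.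
  by rewrite sylvester_telescope !mulmxA.
have negE : A1 *m neg - neg *m A2
    = P1 *m (\sum_s \sum_(1 <= k < (rs s).+1)
               qs s k *m P2s *m (A2 - (c s)%:M) ^- k)
      - (\sum_s \sum_(1 <= k < (rs s).+1)
           (A1 - (c s)%:M) ^- k *m P1 *m qs s k) *m P2s.
  rewrite /neg !(mulmx_sumr, mulmx_suml) -!sumrB; apply: eq_bigr => s _.
  rewrite !(mulmx_sumr, mulmx_suml) -!sumrB; apply: eq_big_nat => k kr.
  rewrite (@eq_big_nat _ _ _ _ _ _ (fun j => (A1 - (c s)%:M) ^- (k.+1 - j)
     *m (P1 *m qs s k *m P2s) *m (A2 - (c s)%:M) ^- j)); last first.
    move=> j jk; rewrite (_ : _ - 1 = - (k.+1 - j)%N%:Z) ?exprnN ?mulmxA //.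
    by lia.
  rewrite !mulmxA -!(mulmxA P1) -!(mulmxA _ P1).
  (* Shifting [A1] and [A2] by the same scalar leaves A1 Z - Z A2 unchanged, so the telescoping can
     be done with the shifted matrices. *)
  have -> : forall Z, A1 *m Z - Z *m A2
     = (A1 - (c s)%:M) *m Z - Z *m (A2 - (c s)%:M) :> 'M[C]_n.+1.
    move=> Z; rewrite mulmxBl mulmxBr mul_scalar_mx mul_mx_scalar.
    by mx_linear.
  by rewrite sylvester_telescopeV // !mulmxA.
transitivity ((A1 *m pos - pos *m A2) - (A1 *m neg - neg *m A2)).
  by rewrite mulmxBr mulmxBl; mx_linear.
by rewrite posE negE mulmxDl mulmxN mulmxDr; mx_linear.
Qed.

(** * The Darboux matrix and its inverse at a fixed lambda *)

Section Darboux.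
Variables (C : fieldType) (m n : nat) (A1 A2 S : 'M[C]_n.+1).
Variables (P1 : 'M[C]_(n.+1, m)) (P2s : 'M[C]_(m, n.+1)) (lam : C).
Hypothesis sylvester : A1 *m S - S *m A2 = P1 *m P2s.
Hypothesis uS : S \in unitmx.
Hypothesis u1 : A1 - lam%:M \in unitmx.
Hypothesis u2 : A2 - lam%:M \in unitmx.

Let R1 : 'M[C]_n.+1 := (A1 - lam%:M)^-1.
Let R2 : 'M[C]_n.+1 := (A2 - lam%:M)^-1.

Definition darboux := 1%:M - P2s *m S^-1 *m R1 *m P1.
Definition darboux_inv := 1%:M + P2s *m R2 *m (S^-1 *m P1).

Let sylvester_shift : P1 *m P2s = (A1 - lam%:M) *m S - S *m (A2 - lam%:M).
Proof.
rewrite -sylvester mulmxBl mulmxBr mul_scalar_mx mul_mx_scalar.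
by mx_linear.
Qed.

(** Placing the shifted Sylvester identity between the two resolvents gives R1 P1 P2s R2 = S R2 - R1
    S, so the quadratic term of the product cancels the two linear ones. *)
Lemma darbouxK : darboux *m darboux_inv = 1%:M.
Proof.
rewrite /darboux /darboux_inv mulmxBl mul1mx mulmxDr mulmx1.
have -> : P2s *m S^-1 *m R1 *m P1 *m (P2s *m R2 *m (S^-1 *m P1))
   = P2s *m R2 *m S^-1 *m P1 - P2s *m S^-1 *m R1 *m P1.
  transitivity (P2s *m S^-1 *m (R1 *m (P1 *m P2s) *m R2) *m S^-1 *m P1).
    by rewrite !mulmxA.
  rewrite sylvester_shift mulmxBr mulmxBl !mulmxA mulVmx // mul1mx.
  rewrite -(mulmxA _ _ R2) mulmxV // mulmx1 mulmxBr !mulmxBl !mulmxA.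
  by rewrite -(mulmxA _ _ S) mulVmx // mulmx1 -(mulmxA _ S) mulmxV // mulmx1.
by rewrite !mulmxA; mx_linear.
Qed.

Lemma darboux_invK : darboux_inv *m darboux = 1%:M.
Proof. exact/mulmx1C/darbouxK. Qed.

(** Multiplication by w trades the resolvent of [A2] in [dress] for that of [A1], the only one
    occurring in the derivative of w. It comes from the Sylvester identity multiplied by [S^-1] on
    both sides. *)
Lemma resolvent_darboux :
  R2 *m (S^-1 *m P1) *m darboux = S^-1 *m R1 *m P1.
Proof.
rewrite /darboux mulmxBr mulmx1.
have -> : R2 *m (S^-1 *m P1) *m (P2s *m S^-1 *m R1 *m P1)
   = R2 *m S^-1 *m P1 - S^-1 *m R1 *m P1.
  transitivity (R2 *m S^-1 *m (P1 *m P2s) *m S^-1 *m R1 *m P1).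
    by rewrite !mulmxA.
  have SV : S *m S^-1 = 1%:M by exact: mulmxV.
  have VS : S^-1 *m S = 1%:M by exact: mulVmx.
  have R1V : (A1 - lam%:M) *m R1 = 1%:M by exact: mulmxV.
  have R2V : R2 *m (A2 - lam%:M) = 1%:M by exact: mulVmx.
  move: sylvester_shift R1V R2V; move: (A1 - _) (A2 - _) => B1 B2 -> R1V R2V.
  rewrite mulmxBr !mulmxBl; congr (_ - _).
    rewrite mulmxA -(mulmxA _ S) SV mulmx1 -(mulmxA _ _ R1) R1V.
    by rewrite mulmx1.
  by rewrite mulmxA -(mulmxA R2) VS mulmx1 R2V mul1mx.
by rewrite !mulmxA; mx_linear.
Qed.

(** When [p1], [p2], [s] are the derivatives of [P1], [P2s], [S], the subtracted term is minus the
    derivative of [darboux]; this is then Gtilde w = w G + w_x. *)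
Lemma dress_darboux g p1 p2 s :
  dress (P2s *m S^-1) (S^-1 *m P1) P1 P2s R1 R2 g (- p1) p2 (- s) *m darboux
  = darboux *m g
    - ((p2 - P2s *m S^-1 *m s) *m S^-1 *m R1 *m P1 + P2s *m S^-1 *m R1 *m p1).
Proof.
rewrite /dress -/darboux -/darboux_inv mulmxBl mulmxDl -!(mulmxA _ darboux_inv).
rewrite darboux_invK !mulmx1 -(mulmxA _ R2) -(mulmxA _ _ darboux).
rewrite resolvent_darboux !mulmxN !mulmxBl !mulmxA.
by mx_linear.
Qed.
End Darboux.

(** * Rational functions: coefficient extraction and Liouville's theorem *)

Lemma poly_vanish_off_roots (C : numFieldType) (p d : {poly C}) :
  d != 0 -> (forall x, d.[x] != 0 -> p.[x] = 0) -> p = 0.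
Proof.
move=> d0 pd; suff : p * d = 0 by move/eqP; rewrite mulf_eq0 (negPf d0) orbF => /eqP.
apply/eqP; apply: contraT => pd0.
(* These natural numbers are distinct in characteristic zero, and there are too many of them to be
   roots of a nonzero [p * d]. *)
pose e := [seq (i%:R : C) | i <- iota 0 (size (p * d))].
suff : (size e < size (p * d)%R)%N by rewrite size_map size_iota ltnn.
apply: max_poly_roots => //.
  apply/allP => _ /mapP[i _ ->]; rewrite rootE hornerM.
  by have [->|/pd->] := eqVneq d.[i%:R] 0; rewrite ?mulr0 ?mul0r.
by rewrite map_inj_uniq ?iota_uniq // => i j /eqP; rewrite eqr_nat => /eqP.
Qed.

(** After multiplication by the common denominator [D], every term except the polar part at [c s] is
    divisible by [lin s ^+ rs s]. As [Ds s] is coprime to [lin s], this power divides the numerator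
    [B s \Po lin s], whose degree is smaller; so each polar part vanishes, and then the polynomial
    part does. *)
Lemma partial_fraction_free (C : numFieldType) (r l : nat) (rs : 'I_l -> nat)
    (c : 'I_l -> C) (a : nat -> C) (b : 'I_l -> nat -> C) : injective c ->
  (forall lam, (forall s, lam != c s) ->
     \sum_(0 <= k < r.+1) a k * lam ^+ k
     + \sum_(s < l) \sum_(1 <= k < (rs s).+1) b s k * (lam - c s) ^- k = 0) ->
  (forall k, (k < r.+1)%N -> a k = 0) /\
  (forall s k, (0 < k <= rs s)%N -> b s k = 0).
Proof.
move=> cI vanish.
pose lin s : {poly C} := 'X - (c s)%:P.
pose D := \prod_s lin s ^+ rs s.
pose Ds s := \prod_(s' | s' != s) lin s' ^+ rs s'.
pose A := \poly_(i < r.+1) a i.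
(* Multiplying the polar part by [(lam - c s) ^+ rs s] reverses its coefficients, whence the index
   [rs s - i]. *)
pose B s := \poly_(i < rs s) b s (rs s - i)%N.
pose P := A * D + \sum_s (B s \Po lin s) * Ds s.
have DE s : D = lin s ^+ rs s * Ds s by rewrite /D (bigD1 s).
have BE s lam : lam != c s ->
    (B s \Po lin s).[lam]
    = (\sum_(1 <= k < (rs s).+1) b s k * (lam - c s) ^- k) * (lam - c s) ^+ rs s.
  move=> ls; rewrite horner_comp hornerXsubC horner_poly big_add1 /= mulr_suml.
  rewrite big_nat_rev add0n big_mkord; apply: eq_bigr => i _ /=.
  rewrite -mulrA; congr (b s _ * _); first by have := ltn_ord i; lia.
  rewrite mulrC -exprB ?unitfE ?subr_eq0 //; last by have := ltn_ord i; lia.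
  by congr (_ ^+ _); have := ltn_ord i; lia.
have D0 : \prod_s lin s != 0 by apply/prodf_neq0 => s _; rewrite polyXsubC_eq0.
have P0 : P = 0.
  apply: (poly_vanish_off_roots D0) => lam; rewrite horner_prod => /prodf_neq0 lamc.
  have {}lamc s : lam != c s by have := lamc s isT; rewrite hornerXsubC subr_eq0.
  rewrite /P hornerD hornerM horner_sum horner_poly -(big_mkord xpredT (fun i => a i * lam ^+ i)).
  under [X in _ + X]eq_bigr => s _.
    rewrite hornerM BE // -mulrA.
    have -> : (lam - c s) ^+ rs s * (Ds s).[lam] = D.[lam].
      by rewrite (DE s) hornerM horner_exp hornerXsubC.
    over.
  by rewrite -mulr_suml -mulrDl vanish ?mul0r.
have B0 s : B s = 0.
  have dvd : lin s ^+ rs s %| (B s \Po lin s) * Ds s.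
    have -> : (B s \Po lin s) * Ds s
      = - (A * D + \sum_(s' | s' != s) (B s' \Po lin s') * Ds s').
      by have := P0; rewrite /P (bigD1 s) //= addrCA => /eqP; rewrite addr_eq0 => /eqP.
    rewrite dvdpNr dvdp_add //; first by rewrite (DE s) dvdp_mull // dvdp_mulr.
    apply: (big_ind (fun p => lin s ^+ rs s %| p)); [exact: dvdp0|by move=> *; exact: dvdp_add|].
    move=> s' s's; apply: dvdp_mull; rewrite /Ds (bigD1 s) 1?eq_sym //=.
    exact: dvdp_mulr.
  move: dvd; rewrite Gauss_dvdpl; last first.
    apply: coprimep_expl; rewrite coprimep_sym coprimep_XsubC rootE horner_prod.
    apply/prodf_neq0 => s' s's; rewrite horner_exp hornerXsubC expf_neq0 //.
    by rewrite subr_eq0 (inj_eq cI) eq_sym.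
  move=> dvd; apply/eqP; apply: contraT => Bs0.
  have sz : size (B s \Po lin s) = size (B s) by rewrite size_comp_poly2 // size_XsubC.
  have : B s \Po lin s != 0 by rewrite -size_poly_eq0 sz size_poly_eq0.
  move=> /dvdp_leq/(_ dvd); rewrite size_exp_XsubC sz => /leq_trans/(_ (size_poly _ _)).
  by rewrite ltnn.
have A0 : A = 0.
  move: P0; rewrite /P big1 => [|s _]; last by rewrite B0 comp_poly0 mul0r.
  rewrite addr0 => /eqP; rewrite mulf_eq0 => /orP[/eqP//|].
  by rewrite /D => /prodf_eq0[s _]; rewrite expf_eq0 polyXsubC_eq0 andbF.
split=> [k kr|s k ks].
  by have := coef_poly r.+1 a k; rewrite kr -/A A0 coef0.
have := coef_poly (rs s) (fun i => b s (rs s - i)%N) (rs s - k).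
rewrite -/(B s) B0 coef0 ltn_subrL; case/andP: (ks) => -> kr.
by rewrite (leq_trans _ kr) ?subKn //; case/andP: ks.
Qed.

(** * Recovering the coefficients of a rational function from finitely many values *)

(** Points are added until the evaluation matrix has full column rank. While the rank is below [n],
    a nonzero column of the cokernel is a nontrivial combination of the [f j] vanishing at all
    chosen points; by independence it is nonzero at some [y] in [P], and adding [y] raises the rank.
    At full rank every coordinate form lies in the row space. *)
Lemma interpolation_of_free (K : fieldType) (T : Type) (P : T -> Prop) (n : nat)
    (f : 'I_n -> T -> K) :
  (forall a : 'I_n -> K, (forall x, P x -> \sum_j a j * f j x = 0) ->
     forall j, a j = 0) ->
  forall j0, exists (N : nat) (x : 'I_N -> T) (b : 'I_N -> K),
    (forall i, P (x i)) /\
    forall j, \sum_i b i * f j (x i) = (j == j0)%:R.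
Proof.
move=> free j0.
have full k : (k <= n)%N -> exists (N : nat) (x : 'I_N -> T),
    (forall i, P (x i)) /\ (k <= \rank (\matrix_(i, j) f j (x i)))%N.
  elim: k => [_|k IH kn].
    have x0 : 'I_0 -> T by case.
    by exists 0, x0; split=> [[]|].
  have [N [x [Px rk]]] := IH (ltnW kn); set M := \matrix_(i, j) _ in rk.
  have [|rk'] := ltnP k (\rank M); first by exists N, x.
  have Mk : \rank M = k by apply/eqP; rewrite eqn_leq rk rk'.
  have cok0 : cokermx M != 0 by rewrite -mxrank_eq0 mxrank_coker Mk subn_eq0 -ltnNge.
  have [i [j ij0]] : exists i j, cokermx M i j != 0.
    apply: contrapT => h; move/eqP: cok0; apply; apply/matrixP => i j; rewrite [RHS]mxE.
    by apply/eqP; apply: contraT => h'; case: h; exists i, j.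
  have [y Py y0] : exists2 y, P y & \sum_i f i y * cokermx M i j != 0.
    apply: contrapT => h; move/eqP: ij0; apply.
    apply: (free (fun i => cokermx M i j)) => y Py.
    under eq_bigr do rewrite mulrC.
    by apply/eqP; apply: contraT => h'; case: h; exists y.
  exists (N + 1)%N, (fun i => match fintype.split i with inl i1 => x i1 | inr _ => y end).
  split=> [i1|]; first by case: fintype.split.
  pose v := \row_j f j y.
  have -> : \matrix_(i, j) f j (match fintype.split i with inl i1 => x i1 | inr _ => y end)
      = col_mx M v.
    by apply/matrixP => i1 j1; rewrite !mxE; case: fintype.split => ?; rewrite mxE.
  rewrite -{1}Mk ltn_neqAle mxrankS ?andbT; last first.
    by rewrite -addsmxE addsmxSl.
  apply/negP => /eqP eqrk.
  have : (col_mx M v <= M)%MS.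
    rewrite -(mxrank_leqif_sup _).2 ?eqrk //.
    by rewrite -addsmxE addsmxSl.
  rewrite -addsmxE addsmx_sub => /andP[_]; rewrite submxE => /eqP/matrixP/(_ 0 j).
  by rewrite !mxE; under eq_bigr do rewrite mxE; move/eqP: y0.
have [N [x [Px rk]]] := full n (leqnn n).
set M := \matrix_(i, j) _ in rk.
have fullM : row_full M by rewrite /row_full eqn_leq rk rank_leq_col.
have /submxP[b bE] := submx_full (delta_mx 0 j0 : 'rV_n) fullM.
exists N, x, (fun i => b 0 i); split=> // j.
move/matrixP/(_ 0 j): bE; rewrite !mxE eqxx /= => ->.
by apply: eq_bigr => i _; rewrite mxE.
Qed.

(** A single finite index type for the whole partial-fraction basis. A polar index is an ordinal
    below [rs s] and stands for the exponent one higher, because the exponents start at 1. *)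
Definition pf_index (r l : nat) (rs : 'I_l -> nat) : finType :=
  ('I_r.+1 + {s : 'I_l & 'I_(rs s)})%type.

Definition pf_basis (K : fieldType) (r l : nat) (rs : 'I_l -> nat) (c : 'I_l -> K)
    (u : pf_index r rs) (lam : K) : K :=
  match u with
  | inl k => lam ^+ k
  | inr v => (lam - c (tag v)) ^- (tagged v).+1
  end.

Definition pf_coef (V : Type) (r l : nat) (rs : 'I_l -> nat)
    (q : nat -> V) (qs : 'I_l -> nat -> V) (u : pf_index r rs) : V :=
  match u with
  | inl k => q k
  | inr v => qs (tag v) (tagged v).+1
  end.

Lemma pf_sumE (K : fieldType) (V : lmodType K) (r l : nat) (rs : 'I_l -> nat)
    (c : 'I_l -> K) (q : nat -> V) (qs : 'I_l -> nat -> V) (lam : K) :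
  \sum_(0 <= k < r.+1) lam ^+ k *: q k
  + \sum_(s < l) \sum_(1 <= k < (rs s).+1) (lam - c s) ^- k *: qs s k
  = \sum_(u : pf_index r rs) pf_basis c u lam *: pf_coef q qs u.
Proof.
rewrite big_sumType /= big_mkord; congr (_ + _).
under eq_bigr do rewrite big_add1 /= big_mkord.
by rewrite (sig_big_dep xpredT (fun _ => xpredT) (fun s (k : 'I_(rs s)) =>
   (lam - c s) ^- k.+1 *: qs s k.+1)).
Qed.

(** The order of the quantifiers matters: nodes [x] and weights [b] are chosen before the
    coefficients, so the same formula holds for coefficients varying with (x,t) and may be
    differentiated. *)
Lemma rational_mx_coefficient (K : numFieldType) (r l : nat) (rs : 'I_l -> nat)
    (c : 'I_l -> K) (u0 : pf_index r rs) : injective c ->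
  exists (N : nat) (x : 'I_N -> K) (b : 'I_N -> K),
    (forall i s, x i != c s) /\
    forall (m : nat) (q : nat -> 'M[K]_m) (qs : 'I_l -> nat -> 'M[K]_m),
      pf_coef q qs u0 = \sum_i b i *: rational_mx r rs c q qs (x i).
Proof.
move=> cI.
have [|N [x [b [xc xb]]]] := @interpolation_of_free K K (fun lam => forall s, lam != c s)
    #|pf_index r rs| (fun j => pf_basis c (enum_val j)) _ (enum_rank u0).
  move=> a van.
  pose a' u := a (enum_rank u).
  suff a0 u : a' u = 0 by move=> j; rewrite -(enum_valK j) -/(a' _) a0.
  (* [p] and [ps] extend the finite family [a'] to natural indices, with arbitrary values out of
     range; [k.-1] undoes the shift of exponents in [pf_index]. *)
  pose p k : K^o := a' (inl (inord k)).
  pose ps (s : 'I_l) (k : nat) : K^o :=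
    oapp (fun i : 'I_(rs s) => a' (inr (Tagged (fun s => 'I_(rs s)) i))) 0 (insub k.-1).
  have coefE v : pf_coef p ps v = a' v.
    case: v => [k|[s k]]; rewrite /pf_coef /p /ps /=; first by rewrite inord_val.
    by rewrite valK.
  have [] := @partial_fraction_free K r l rs c p ps cI.
    move=> lam lamc; rewrite -[RHS](van lam lamc).
    rewrite (reindex_onto enum_rank enum_val); last by move=> ? _; rewrite enum_valK.
    under [RHS]eq_bigl do rewrite enum_rankK eqxx.
    under [RHS]eq_bigr do rewrite enum_rankK -/(a' _) mulrC -coefE.
    rewrite -(@pf_sumE K K^o).
    by congr (_ + _); [|apply: eq_bigr => s _]; apply: eq_bigr => k _; exact: mulrC.
  move=> p0 ps0; rewrite -coefE; case: u => [k|[s k]] /=; first exact: p0.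
  by apply: ps0; rewrite ltn_ord.
(* The sign compensates the minus signs in [rational_mx]. *)
exists N, x, (fun i => - b i); split=> // m q qs.
under eq_bigr do rewrite /rational_mx -opprD scalerN scaleNr opprK pf_sumE scaler_sumr.
rewrite exchange_big /= (bigD1 u0) //= [X in _ + X]big1 ?addr0.
  under eq_bigr do rewrite scalerA.
  rewrite -scaler_suml; have := xb (enum_rank u0).
  by rewrite eqxx enum_rankK => ->; rewrite scale1r.
move=> u uu0; under eq_bigr do rewrite scalerA.
rewrite -scaler_suml; have := xb (enum_rank u).
by rewrite (inj_eq enum_rank_inj) (negPf uu0) enum_rankK => ->; rewrite scale0r.
Qed.

(* Off [W], [e] is a rational function p / d with all poles in [W] which is
   O(lam^-k) at infinity. *)
Definition rational_order (C : fieldType) (W : C -> Prop) (k : int) (e : C -> C) : Prop :=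
  exists d p : {poly C},
    [/\ d != 0, p != 0 -> (size p)%:Z + k <= (size d)%:Z &
        forall lam, ~ W lam -> d.[lam] != 0 /\ e lam * d.[lam] = p.[lam]].

Section RationalOrder.
Variables (C : fieldType) (W : C -> Prop).
Implicit Types (e : C -> C).

Lemma rational_orderW k k' e : k' <= k ->
  rational_order W k e -> rational_order W k' e.
Proof.
move=> kk [d [p [d0 sz ed]]]; exists d, p; split=> // /sz; apply: le_trans.
by rewrite lerD2l.
Qed.

Lemma rational_order0 k : rational_order W k (fun=> 0).
Proof.
exists 1, 0; split; rewrite ?oner_eq0 ?eqxx // => lam _.
by rewrite !hornerE oner_eq0.
Qed.

Lemma rational_order_cst a : rational_order W 0 (fun=> a).
Proof.
exists 1, a%:P; split; first by rewrite oner_eq0.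
  by rewrite size_poly1 addr0 => _; rewrite lez_nat size_polyC leq_b1.
by move=> lam _; rewrite !hornerE oner_eq0.
Qed.

Lemma rational_order_exp k : rational_order W (- k%:Z) (fun lam => lam ^+ k).
Proof.
exists 1, 'X^k; split; first by rewrite oner_eq0.
  by rewrite size_polyXn size_poly1; lia.
by move=> lam _; rewrite !hornerE oner_eq0.
Qed.

Lemma rational_order_expV a k : W a ->
  rational_order W k%:Z (fun lam => (lam - a) ^- k).
Proof.
move=> Wa; exists (('X - a%:P) ^+ k), 1; split.
- by rewrite expf_neq0 // polyXsubC_eq0.
- by rewrite size_poly1 size_exp_XsubC; lia.
move=> lam Wlam; rewrite horner_exp hornerXsubC !hornerE.
have la : (lam - a) ^+ k != 0.
  by rewrite expf_neq0 // subr_eq0; apply/eqP => e; apply: Wlam; rewrite e.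
by rewrite la mulVf.
Qed.

Lemma rational_orderD k e e' : rational_order W k e -> rational_order W k e' ->
  rational_order W k (fun lam => e lam + e' lam).
Proof.
move=> [d [p [d0 sz ed]]] [d' [p' [d'0 sz' ed']]].
have sM (u v : {poly C}) : u != 0 -> v != 0 -> size (u * v) = (size u + size v).-1.
  exact: size_mul.
have sD (u v : {poly C}) : (size (u + v)%R <= maxn (size u) (size v))%N.
  exact: size_polyD.
have s0 (u : {poly C}) : u != 0 -> (0 < size u)%N by rewrite size_poly_gt0.
have [dn d'n] := (s0 _ d0, s0 _ d'0).
pose q : {poly C} := p * d' + p' * d; have sq : (size q <= _)%N := sD _ _.
exists (d * d'), q; split; first by rewrite mulf_neq0.
  rewrite (sM d) //; have [p0|p0] := eqVneq p 0.
    rewrite /q p0 mul0r add0r mulf_eq0 negb_or => /andP[p'0 _].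
    by move: (sz' p'0) (s0 _ p'0); rewrite (sM p') //; clear -dn d'n; lia.
  move: (sz p0) (s0 _ p0); have [p'0|p'0] := eqVneq p' 0.
    by rewrite /q p'0 mul0r addr0 (sM p) //; clear -dn d'n; lia.
  move=> szp sp _; move: szp sp (sz' p'0) (s0 _ p'0) sq.
  by rewrite (sM p) // (sM p') //; clear -dn d'n; move: q => q; lia.
move=> lam Wlam; have [dl el] := ed lam Wlam; have [dl' el'] := ed' lam Wlam.
by rewrite /q hornerD !hornerM mulf_neq0 // -el -el'; split=> //; ring.
Qed.

Lemma rational_orderM k k' e e' : rational_order W k e -> rational_order W k' e' ->
  rational_order W (k + k') (fun lam => e lam * e' lam).
Proof.
move=> [d [p [d0 sz ed]]] [d' [p' [d'0 sz' ed']]].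
have sM (u v : {poly C}) : u != 0 -> v != 0 -> size (u * v) = (size u + size v).-1.
  exact: size_mul.
have s0 (u : {poly C}) : u != 0 -> (0 < size u)%N by rewrite size_poly_gt0.
have [dn d'n] := (s0 _ d0, s0 _ d'0).
exists (d * d'), (p * p'); split; first by rewrite mulf_neq0.
  rewrite mulf_eq0 negb_or => /andP[p0 p'0]; rewrite !sM //.
  by move: (sz p0) (s0 _ p0) (sz' p'0) (s0 _ p'0); clear -dn d'n; lia.
move=> lam Wlam; have [dl el] := ed lam Wlam; have [dl' el'] := ed' lam Wlam.
by rewrite !hornerM mulf_neq0 // -el -el'; split=> //; ring.
Qed.

Lemma rational_order_sum k (J : Type) (s : seq J) (P : pred J) (e : J -> C -> C) :
  (forall j, rational_order W k (e j)) ->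
  rational_order W k (fun lam => \sum_(j <- s | P j) e j lam).
Proof.
move=> ek; elim: s => [|j s IH].
  by under eq_fun do rewrite big_nil; exact: rational_order0.
under eq_fun do rewrite big_cons; case: (P j) => //.
exact: rational_orderD.
Qed.

Lemma rational_orderS W' k e : (forall lam, W lam -> W' lam) ->
  rational_order W k e -> rational_order W' k e.
Proof.
move=> sub [d [p [d0 sz ed]]]; exists d, p; split=> // lam W'lam.
by apply: ed => /sub.
Qed.

End RationalOrder.

(* Writing e = p / d and e' = h / x, the denominators d and x are coprime as [Z]
   and [W] are disjoint, so x divides h, whose degree is smaller. *)
Lemma rational_liouville (C : numClosedFieldType) (Z W : C -> Prop) (k : int)
    (e e' : C -> C) (z w : {poly C}) :
  z != 0 -> (forall lam, Z lam -> root z lam) ->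
  w != 0 -> (forall lam, W lam -> root w lam) ->
  rational_order Z k e -> rational_order W 1 e' ->
  (forall lam, Z lam -> ~ W lam) ->
  (forall lam, ~ Z lam -> ~ W lam -> e lam = e' lam) ->
  forall lam, ~ Z lam -> e lam = 0.
Proof.
move=> z0 Zz w0 Ww [d [p [d0 _ ed]]] [x [h [x0 sz ex]]] disj ee' lam Zlam.
have eq_poly : p * x = h * d.
  apply/eqP; rewrite -subr_eq0; apply/eqP.
  (* [z] and [w] witness that [Z] and [W] are finite, so the two expressions agree at all but
     finitely many points. *)
  apply: (@poly_vanish_off_roots _ _ (z * w)); first by rewrite mulf_neq0.
  move=> y; rewrite hornerM mulf_eq0 negb_or => /andP[zy wy].
  have Zy : ~ Z y by move=> /Zz; apply/negP.
  have Wy : ~ W y by move=> /Ww; apply/negP.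
  have [_ edy] := ed y Zy; have [_ exy] := ex y Wy.
  by rewrite hornerD hornerN !hornerM -edy -exy ee' //; ring.
have cop : coprimep x d.
  apply: Pdiv.ClosedField.root_coprimep => y /eqP xy.
  have Wy : W y by apply: contrapT => /ex[]; rewrite xy eqxx.
  by have [] := ed y (fun Zy => disj y Zy Wy).
have h0 : h = 0.
  apply/eqP; apply: contraT => h0; have := sz h0; rewrite -PoszD lez_nat addn1 => szh.
  have : x %| h by rewrite -(Gauss_dvdpl _ cop) -eq_poly dvdp_mull.
  by move=> /(dvdp_leq h0); rewrite leqNgt szh.
have p0 : p = 0.
  by move/eqP: eq_poly; rewrite h0 mul0r mulf_eq0 (negPf x0) orbF => /eqP.
have [dl] := ed lam Zlam; rewrite p0 horner0 => /eqP.
by rewrite mulf_eq0 (negPf dl) orbF => /eqP.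
Qed.

(** * Entrywise orders of rational matrix functions of lambda *)

Definition rational_mx_order (C : fieldType) (W : C -> Prop) (k : int) (m n : nat)
    (M : C -> 'M[C]_(m, n)) : Prop :=
  forall i j, rational_order W k (fun lam => M lam i j).

Section RationalMxOrder.
Variables (C : fieldType) (W : C -> Prop).

Lemma rational_mx_orderW k k' m n (M : C -> 'M[C]_(m, n)) : k' <= k ->
  rational_mx_order W k M -> rational_mx_order W k' M.
Proof. by move=> kk Mk i j; apply: rational_orderW kk _. Qed.

Lemma rational_mx_order_cst m n (M : 'M[C]_(m, n)) : rational_mx_order W 0 (fun=> M).
Proof. by move=> i j; apply: rational_order_cst. Qed.

Lemma rational_mx_orderD k m n (M N : C -> 'M[C]_(m, n)) :
  rational_mx_order W k M -> rational_mx_order W k N ->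
  rational_mx_order W k (fun lam => M lam + N lam).
Proof.
move=> Mk Nk i j; under eq_fun do rewrite mxE.
exact: rational_orderD.
Qed.

Lemma rational_mx_orderM k k' m n p (M : C -> 'M[C]_(m, n)) (N : C -> 'M[C]_(n, p)) :
  rational_mx_order W k M -> rational_mx_order W k' N ->
  rational_mx_order W (k + k') (fun lam => M lam *m N lam).
Proof.
move=> Mk Nk i j; under eq_fun do rewrite mxE.
by apply: rational_order_sum => u; apply: rational_orderM.
Qed.

Lemma rational_mx_orderZ k k' m n (a : C -> C) (M : C -> 'M[C]_(m, n)) :
  rational_order W k a -> rational_mx_order W k' M ->
  rational_mx_order W (k + k') (fun lam => a lam *: M lam).
Proof.
move=> ak Mk i j; under eq_fun do rewrite mxE.
exact: rational_orderM.
Qed.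

Lemma rational_mx_orderN k m n (M : C -> 'M[C]_(m, n)) :
  rational_mx_order W k M -> rational_mx_order W k (fun lam => - M lam).
Proof.
move=> Mk; under eq_fun do rewrite -scaleN1r.
by rewrite -[k]add0r; apply: rational_mx_orderZ => //; apply: rational_order_cst.
Qed.

Lemma rational_mx_order_sum k m n (J : Type) (s : seq J) (P : pred J)
    (M : J -> C -> 'M[C]_(m, n)) : (forall j, rational_mx_order W k (M j)) ->
  rational_mx_order W k (fun lam => \sum_(j <- s | P j) M j lam).
Proof.
move=> Mk i j; under eq_fun do rewrite summxE.
by apply: rational_order_sum => u; apply: Mk.
Qed.
End RationalMxOrder.

Lemma size_det_leq (C : idomainType) (n : nat) (M : 'M[{poly C}]_n) :
  (forall i j, size (M i j) <= 2)%N -> (size (\det M) <= n.+1)%N.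
Proof.
move=> sz; rewrite /determinant; apply: leq_trans (size_sum _ _ _) _.
apply/bigmax_leqP => s _; rewrite -signr_odd /= size_Msign.
apply: leq_trans (size_prod_leq _ _) _; rewrite leq_subLR card_ord.
apply: (@leq_trans (\sum_(i < n) 2).+1).
  by rewrite ltnS; apply: leq_sum => i _; apply: sz.
by rewrite sum_nat_const card_ord; lia.
Qed.

(** Cramer's rule: the adjugate entries are minors of order [n] with entries of degree at most one,
    so their size is at most [n.+1], against [n.+2] for the characteristic polynomial. The sign
    arises because [char_poly_mx A] evaluates to [lam - A]. *)
Lemma rational_mx_order_resolvent (C : fieldType) (n : nat) (A : 'M[C]_n.+1) :
  rational_mx_order (fun lam => A - lam%:M \isn't a GRing.unit) 1
    (fun lam => (A - lam%:M)^-1).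
Proof.
move=> i j; exists (char_poly A), (- \adj (char_poly_mx A) i j); split.
- by rewrite monic_neq0 // char_poly_monic.
- move=> _; rewrite size_char_poly size_polyN mxE /cofactor -signr_odd size_Msign.
  rewrite -PoszD lez_nat addn1 ltnS; apply: size_det_leq => k l.
  rewrite !mxE; apply: leq_trans (size_polyD _ _) _; rewrite geq_max size_polyN.
  rewrite (leq_trans (size_polyC_leq1 _)) // andbT.
  by case: eqP; rewrite ?mulr1n ?mulr0n ?size_polyX ?size_poly0.
move=> lam /negP; rewrite negbK => u.
have evalE : map_mx (horner_eval lam) (char_poly_mx A) = - (A - lam%:M).
  apply/matrixP => k l; rewrite !mxE /horner_eval hornerD hornerN hornerC hornerMn hornerX.
  by rewrite opprB.
have detE : (char_poly A).[lam] = \det (- (A - lam%:M)).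
  by rewrite -evalE det_map_mx.
have adjE : (\adj (char_poly_mx A) i j).[lam] = \adj (- (A - lam%:M)) i j.
  by rewrite -evalE -map_mx_adj [RHS]mxE.
have uN : - (A - lam%:M) \in unitmx.
  by rewrite -scaleN1r unitmxZ ?unitrN1.
split; first by rewrite detE -unitfE -unitmxE.
rewrite hornerN adjE detE.
have -> : (A - lam%:M)^-1 = - (invmx (- (A - lam%:M))).
  by rewrite -[invmx _]/(_^-1) invrN opprK.
rewrite /invmx uN !mxE mulNr; congr (- _).
by rewrite mulrAC mulVf ?mul1r // -unitfE -unitmxE.
Qed.

Lemma rational_mx_order_rational (C : fieldType) (W : C -> Prop) (m r l : nat)
    (rs : 'I_l -> nat) (c : 'I_l -> C) (q : nat -> 'M[C]_m) (qs : 'I_l -> nat -> 'M[C]_m) :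
  (forall s, W (c s)) ->
  exists k, rational_mx_order W k (rational_mx r rs c q qs).
Proof.
move=> Wc; exists (- r%:Z); rewrite /rational_mx.
under eq_fun do rewrite -opprD.
apply: rational_mx_orderN; apply: rational_mx_orderD.
  under eq_fun do rewrite big_mkord.
  apply: rational_mx_order_sum => k.
  apply: (@rational_mx_orderW _ _ (- k%:Z + 0)); first by have := ltn_ord k; lia.
  apply: rational_mx_orderZ; first exact: rational_order_exp.
  exact: rational_mx_order_cst.
apply: rational_mx_order_sum => s; apply: rational_mx_order_sum => k.
apply: (@rational_mx_orderW _ _ (k%:Z + 0)); first by lia.
apply: rational_mx_orderZ; first exact: rational_order_expV.
exact: rational_mx_order_cst.
Qed.

(** * Derivatives along an interval *)

Section DerivativeCalculus.
Local Open Scope classical_set_scope.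
Local Open Scope ring_scope.
Local Open Scope complex_scope.

Lemma cvg_mxP (K : numFieldType) (T : Type) (m n : nat) (F : set_system T)
    (f : T -> 'M[K]_(m, n)) (M : 'M[K]_(m, n)) : Filter F ->
  f @ F --> M <-> forall i j, (fun y => f y i j) @ F --> M i j.
Proof.
move=> FF; split=> [fM i j|fM].
  by apply: (cvg_comp f (fun N : 'M[K]_(m, n) => N i j) fM); exact: coord_continuous.
move=> A [P MP PA]; apply: (@filterS _ F _ (fun y => forall i j, P i j (f y i j))).
  by move=> y Py; apply: PA.
by do 2![apply: filter_forall => ?]; exact: fM.
Qed.

Section Derivatives.
Variables (R : realType) (I : interval R).
Implicit Types x : R.
Local Notation C := (R[i]).

Lemma is_derivative_in_mxP m n x (f : R -> 'M[C]_(m, n)) f' :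
  is_derivative_in I f x f' <->
  forall i j, @is_derivative_in R (R[i]^o) I (fun y => f y i j) x (f' i j).
Proof.
rewrite /is_derivative_in cvg_mxP; split=> h i j; have := h i j; rewrite /GRing.scale /=.
  by under eq_fun do rewrite !mxE.
by under [in X in _ -> X]eq_fun do rewrite !mxE.
Qed.

Section Calculus.
Variables (V : normedModType C) (x : R).
Implicit Types f g : R -> V.

Lemma is_derivative_in_cst (a : V) : is_derivative_in I (fun=> a) x 0.
Proof.
rewrite /is_derivative_in; under eq_fun do rewrite subrr scaler0.
exact: cvg_cst.
Qed.

Lemma is_derivative_inD f g (f' g' : V) :
  is_derivative_in I f x f' -> is_derivative_in I g x g' ->
  is_derivative_in I (fun y => f y + g y) x (f' + g').
Proof.
rewrite /is_derivative_in => df dg.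
under eq_fun do rewrite opprD addrACA scalerDr.
exact: cvgD.
Qed.

Lemma is_derivative_inZ a f (f' : V) :
  is_derivative_in I f x f' -> is_derivative_in I (fun y => a *: f y) x (a *: f').
Proof.
rewrite /is_derivative_in => df.
under eq_fun do rewrite -scalerBr scalerA mulrC -scalerA.
exact: cvgZr.
Qed.

Lemma is_derivative_in_near f g (f' : V) : f x = g x ->
  (\forall y \near within [set` I] x^', f y = g y) ->
  is_derivative_in I f x f' -> is_derivative_in I g x f'.
Proof.
rewrite /is_derivative_in => fgx fg; apply: cvg_trans; apply: near_eq_cvg.
by apply: filterS fg => y fgy; rewrite fgy fgx.
Qed.

Lemma is_derivative_in_cvg f (f' : V) :
  is_derivative_in I f x f' -> f @ within [set` I] x^' --> f x.
Proof.
rewrite /is_derivative_in => df.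
have idF : y @[y --> within [set` I] x^'] --> x.
  by apply: cvg_trans (cvg_within _) _; apply: cvg_within.
have d0 : (fun y => ((y - x)%:C : C) *: (((y - x)%:C : C)^-1 *: (f y - f x)))
    @ within [set` I] x^' --> (0 : V).
  rewrite -[0 : V](scale0r f'); apply: cvgZ => //.
  apply/cvgr0Pnorm_lt => -[e e']; rewrite ltcE /= => /andP[/eqP -> e0].
  have /cvgrPdist_lt/(_ _ e0) := idF; apply: filterS => y.
  by rewrite distrC normc_def /= expr0n addr0 sqrtr_sqr ltcR.
rewrite -[f x]addr0; apply: cvg_trans (cvgD (cvg_cst (f x)) d0).
apply: near_eq_cvg; near=> y.
have yx : ((y - x)%:C : C) != 0.
  suff : y != x by rewrite -subr_eq0 eq_complex /= eqxx andbT.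
  near: y; apply: cvg_within; exact: withinT.
by rewrite !fctE scalerA mulfV // scale1r addrC subrK.
Unshelve. all: by end_near. Qed.
End Calculus.

Lemma within_dnbhs_proper x : nondegenerate_interval I -> x \in I ->
  ProperFilter (within [set` I] x^').
Proof.
move=> [p [q [pI qI pq]]] xI; apply: Build_ProperFilter_ex => P.
rewrite /within /= /dnbhs /within /= => /nbhs_ballP[e /= e0 He].
have [z zI zx] : exists2 z, z \in I & z != x.
  by have [<-|px] := eqVneq p x; [exists q; rewrite ?gt_eqF|exists p].
(* The bound 1 keeps the point between [x] and [z], hence in [I]; the other bound keeps it within
   [e / 2] of [x]. *)
pose d := Num.min 1 (e / (2 * `|z - x|)).
have zx0 : 0 < `|z - x| by rewrite normr_gt0 subr_eq0.
have d0 : 0 < d by rewrite lt_min ltr01 divr_gt0 // mulr_gt0.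
have d1 : d <= 1 by rewrite ge_min lexx.
exists (x + d * (z - x)); apply: He.
- rewrite /ball /= opprD addrA subrr add0r normrN normrM gtr0_norm //.
  apply: (@le_lt_trans _ _ (e / 2)); last by rewrite ltr_pdivrMr // ltr_pMr // ltr1n.
  rewrite (_ : e / 2 = e / (2 * `|z - x|) * `|z - x|).
    by rewrite ler_pM2r // ge_min lexx orbT.
  by rewrite invfM mulrA mulfVK // gt_eqF.
- by rewrite -subr_eq0 addrC addKr mulf_neq0 ?subr_eq0 // gt_eqF.
- have itv := @interval_is_interval R I.
  have [zlx|xlz] := ltP z x.
    by apply: (itv z x) => //; apply/andP; split; nra.
  by apply: (itv x z) => //; apply/andP; split; nra.
Qed.

Lemma is_derivative_in_unique (V : normedModType C) x (f : R -> V) (a b : V) :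
  nondegenerate_interval I -> x \in I ->
  is_derivative_in I f x a -> is_derivative_in I f x b -> a = b.
Proof.
move=> ndI xI da db; have ? := within_dnbhs_proper ndI xI.
exact: (norm_cvg_unique da db).
Qed.

Lemma is_derivative_in_sum (V : normedModType C) x (J : Type) (e : seq J)
    (P : pred J) (f : J -> R -> V) (f' : J -> V) :
  (forall i, P i -> is_derivative_in I (f i) x (f' i)) ->
  is_derivative_in I (fun y => \sum_(i <- e | P i) f i y) x
    (\sum_(i <- e | P i) f' i).
Proof.
move=> df; elim: e => [|i e IH].
  rewrite big_nil; under eq_fun do rewrite big_nil.
  exact: is_derivative_in_cst.
rewrite big_cons; under eq_fun do rewrite big_cons.
by case: ifP => // Pi; apply: is_derivative_inD => //; exact: df.
Qed.

Lemma is_derivative_inN (V : normedModType C) x (f : R -> V) (f' : V) :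
  is_derivative_in I f x f' -> is_derivative_in I (fun y => - f y) x (- f').
Proof.
move=> /(is_derivative_inZ (a := -1)); rewrite scaleN1r.
by under eq_fun do rewrite scaleN1r.
Qed.

Lemma is_derivative_inB (V : normedModType C) x (f g : R -> V) (f' g' : V) :
  is_derivative_in I f x f' -> is_derivative_in I g x g' ->
  is_derivative_in I (fun y => f y - g y) x (f' - g').
Proof. by move=> df /is_derivative_inN; exact: is_derivative_inD. Qed.
End Derivatives.

(** * Limits and derivatives of products and inverses of matrices *)

Section MatrixLimits.
Context (K : numFieldType) (T : Type) (F : set_system T) {FF : Filter F}.

Lemma cvg_finite_sum (J : Type) (e : seq J) (P : pred J) (f : J -> T -> K) (a : J -> K) :
  (forall i, f i @ F --> a i) ->
  (fun y => \sum_(i <- e | P i) f i y) @ F --> \sum_(i <- e | P i) a i.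
Proof.
move=> fa; elim: e => [|i e IH].
  by rewrite big_nil; under eq_fun do rewrite big_nil; exact: cvg_cst.
rewrite big_cons; under eq_fun do rewrite big_cons.
by case: (P i) => //; apply: (@cvgD _ K^o).
Qed.

Lemma cvg_finite_prod (J : Type) (e : seq J) (P : pred J) (f : J -> T -> K) (a : J -> K) :
  (forall i, f i @ F --> a i) ->
  (fun y => \prod_(i <- e | P i) f i y) @ F --> \prod_(i <- e | P i) a i.
Proof.
move=> fa; elim: e => [|i e IH].
  by rewrite big_nil; under eq_fun do rewrite big_nil; exact: cvg_cst.
rewrite big_cons; under eq_fun do rewrite big_cons.
by case: (P i) => //; apply: cvgM.
Qed.

Lemma cvg_mulmx (m n p : nat) (f : T -> 'M[K]_(m, n)) (g : T -> 'M[K]_(n, p))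
    (A : 'M[K]_(m, n)) (B : 'M[K]_(n, p)) :
  f @ F --> A -> g @ F --> B -> (fun y => f y *m g y) @ F --> A *m B.
Proof.
move=> /cvg_mxP fA /cvg_mxP gB; apply/cvg_mxP => i j; rewrite mxE.
under eq_fun do rewrite mxE.
by apply: cvg_finite_sum => k; apply: cvgM.
Qed.

Lemma cvg_det (n : nat) (f : T -> 'M[K]_n) (A : 'M[K]_n) :
  f @ F --> A -> (fun y => \det (f y)) @ F --> \det A.
Proof.
move=> /cvg_mxP fA; apply: cvg_finite_sum => s; apply: cvgM; first exact: cvg_cst.
exact: cvg_finite_prod.
Qed.

Lemma near_unitmx (n : nat) (f : T -> 'M[K]_n) (A : 'M[K]_n) :
  f @ F --> A -> A \in unitmx -> \forall y \near F, f y \in unitmx.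
Proof.
move=> /cvg_det dfA; rewrite unitmxE unitfE => A0.
have near0 : \forall y \near F, \det (f y) != 0.
  exact: (@cvgr_neq0 K K^o T F FF _ _ dfA A0).
by apply: filterS near0 => y; rewrite unitmxE unitfE.
Qed.

(** [invmx] equals the adjugate over the determinant only on invertible matrices, so that formula is
    used where [f y] is invertible, which holds eventually. *)
Lemma cvg_invmx (n : nat) (f : T -> 'M[K]_n) (A : 'M[K]_n) :
  f @ F --> A -> A \in unitmx -> (fun y => invmx (f y)) @ F --> invmx A.
Proof.
move=> fA uA; have near_u := near_unitmx fA uA.
apply: (cvg_trans (near_eq_cvg (f := fun y => (\det (f y))^-1 *: \adj (f y)) _)).
  by apply: filterS near_u => y; rewrite /invmx => ->.
rewrite /invmx uA; apply: cvgZ.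
  by apply: cvgV; [rewrite -unitfE -unitmxE|exact: cvg_det].
apply/cvg_mxP => i j; rewrite mxE; under eq_fun do rewrite mxE.
apply: cvgM; first exact: cvg_cst.
apply: cvg_det; apply/cvg_mxP => k l; rewrite !mxE.
by under eq_fun do rewrite !mxE; move/cvg_mxP: fA; exact.
Qed.
End MatrixLimits.

Section MatrixDerivatives.
Variables (R : realType) (I : interval R) (x : R).
Local Notation C := (R[i]).

Lemma is_derivative_in_mulmx (m n p : nat) (f : R -> 'M[C]_(m, n))
    (g : R -> 'M[C]_(n, p)) f' g' :
  is_derivative_in I f x f' -> is_derivative_in I g x g' ->
  is_derivative_in I (fun y => f y *m g y) x (f' *m g x + f x *m g').
Proof.
move=> df dg; rewrite /is_derivative_in.
have cg := is_derivative_in_cvg dg.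
have cfx := is_derivative_in_cvg (is_derivative_in_cst I x (f x)).
have L := cvgD (cvg_mulmx df cg) (cvg_mulmx cfx dg).
refine (cvg_trans _ (L _ _ _)); apply: near_eq_cvg; near=> y.
rewrite !fctE -scalemxAl -scalemxAr -scalerDr mulmxBl mulmxBr.
by rewrite addrA subrK.
Unshelve. all: by end_near. Qed.

Lemma is_derivative_in_mulmxl (m n p : nat) (M : 'M[C]_(m, n)) (f : R -> 'M[C]_(n, p)) f' :
  is_derivative_in I f x f' -> is_derivative_in I (fun y => M *m f y) x (M *m f').
Proof.
move=> df; have := is_derivative_in_mulmx (is_derivative_in_cst I x M) df.
by rewrite mul0mx add0r.
Qed.

Lemma is_derivative_in_mulmxr (m n p : nat) (f : R -> 'M[C]_(m, n)) (M : 'M[C]_(n, p)) f' :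
  is_derivative_in I f x f' -> is_derivative_in I (fun y => f y *m M) x (f' *m M).
Proof.
move=> df; have := is_derivative_in_mulmx df (is_derivative_in_cst I x M).
by rewrite mulmx0 addr0.
Qed.

Lemma is_derivative_in_invmx (n : nat) (S : R -> 'M[C]_n) S' :
  S x \in unitmx -> is_derivative_in I S x S' ->
  is_derivative_in I (fun y => invmx (S y)) x (- (invmx (S x) *m S' *m invmx (S x))).
Proof.
move=> uS dS; rewrite /is_derivative_in.
have cS := is_derivative_in_cvg dS.
have near_u : \forall y \near within [set` I] x^', S y \in unitmx.
  exact: near_unitmx cS uS.
have cVx := is_derivative_in_cvg (is_derivative_in_cst I x (invmx (S x))).
have L := cvgN (cvg_mulmx (cvg_mulmx (cvg_invmx cS uS) dS) cVx).
refine (cvg_trans _ (L _ _ _ _)); apply: near_eq_cvg; apply: filterS near_u => y uy.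
rewrite !fctE -scalemxAr -scalemxAl -scalerN; congr (_ *: _).
by rewrite mulmxBr mulmxBl mulVmx // mul1mx -mulmxA mulmxV // mulmx1 opprB.
Qed.
End MatrixDerivatives.

(** Mean value theorem on the segment between the two points, which lies in [I]: in its interior the
    limit within [I] is the ordinary derivative, and at its ends continuity is enough. *)
Lemma zero_derivative_cst (R : realType) (I : interval R) (g : R -> R) :
  (forall x, x \in I ->
     (fun y => (y - x)^-1 * (g y - g x)) @ within [set` I] x^' --> (0 : R)) ->
  {in I &, forall x y, g x = g y}.
Proof.
move=> dg; suff H x y : x \in I -> y \in I -> x < y -> g x = g y.
  by move=> x y xI yI; have [/H->|/H->|->] := ltgtP x y.
move=> xI yI xy.
have sub z : x <= z <= y -> z \in I by exact: (@interval_is_interval R I).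
have near_I (P : set R) z : (\forall w \near within [set` I] z^', P w) ->
    exists2 e : R, 0 < e & forall w, `|z - w| < e -> w \in I -> w != z -> P w.
  rewrite /within /= /dnbhs /within /= => /nbhs_ballP[e /= e0 He].
  by exists e => // w we wI wz; apply: He.
have [z zxy||c _ /eqP] := @MVT R g (fun=> 0) x y xy; last first.
- by rewrite mul0r subr_eq0 => /eqP ->.
- apply/subspace_continuousP => z; rewrite /= in_itv /= => /sub zI.
  apply/cvgrPdist_lt => e e0.
  (* A quotient of modulus below 1 bounds the increments of [g] by those of the argument. *)
  have /cvgr0Pnorm_lt/(_ 1 ltr01)/near_I[d d0 Hd] := dg z zI.
  near=> w.
  have [->|wz] := eqVneq w z; first by rewrite subrr normr0.
  have wI : w \in I.
    by apply: sub; near: w; apply: withinT.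
  have wd : `|z - w| < d.
    by near: w; apply: cvg_within; apply/nbhs_ballP; exists d.
  have we : `|z - w| < e.
    by near: w; apply: cvg_within; apply/nbhs_ballP; exists e.
  have := Hd w wd wI wz; rewrite normrM normfV ltr_pdivrMl ?normr_gt0 ?subr_eq0 //.
  by rewrite mulr1 => gw; rewrite distrC (lt_trans gw) // distrC.
- have zI : z \in I by apply: sub; rewrite !ltW // (itvP zxy).
  have L : h^-1 *: ((g \o shift z) (h *: (1 : R)) - g z) @[h --> 0^'] --> (0 : R).
    apply/cvgr0Pnorm_lt => e e0.
    have /cvgr0Pnorm_lt/(_ e e0)/near_I[d d0 Hd] := dg z zI.
    near=> h.
    have h0 : h != 0 by near: h; exact: nbhs_dnbhs_neq.
    have hd : `|h| < d by near: h; exact: dnbhs0_lt.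
    (* For small [h] the point stays in the open segment, hence in [I], so the limit within [I]
       yields the two-sided one. *)
    have hxy : h + z \in `]x, y[.
      have : `|h| < Num.min (z - x) (y - z).
        near: h; apply: dnbhs0_lt.
        by rewrite lt_min !subr_gt0 !(itvP zxy).
      rewrite lt_min !ltr_norml in_itv /= => /andP[/andP[? _] /andP[_ ?]].
      by apply/andP; split; lra.
    have := Hd (h + z); rewrite /= opprD addrCA subrr addr0 normrN => /(_ hd).
    rewrite -subr_eq0 addrK => /(_ _ h0); rewrite /GRing.scale /= mulr1; apply.
    by apply: sub; rewrite !ltW // (itvP hxy).
  by apply: DeriveDef; [apply/cvg_ex; exists 0|apply: (cvg_lim _ L)].
Unshelve. all: by end_near.
Qed.

Lemma is_derivative_in0_cst (R : realType) (I : interval R) (m n : nat)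
    (f : R -> 'M[R[i]]_(m, n)) :
  (forall x, x \in I -> is_derivative_in I f x 0) ->
  {in I &, forall x y, f x = f y}.
Proof.
move=> df x y xI yI; apply/matrixP => i j.
have {}df z : z \in I -> @is_derivative_in R (R[i]^o) I (fun w => f w i j) z 0.
  by move=> /df /is_derivative_in_mxP/(_ i j); rewrite mxE.
have quotE (a : R) (z : R[i]) : (a%:C)^-1 * z = (a^-1 * complex.Re z) +i* (a^-1 * complex.Im z).
  rewrite -fmorphV; case: z => u v; apply/eqP.
  by rewrite eq_complex /= !mul0r subr0 addr0 !eqxx.
have norm_lt (z : R[i]) e : `|z| < e%:C -> `|complex.Re z| < e /\ `|complex.Im z| < e.
  move=> ze; split; rewrite -ltcR; apply: le_lt_trans ze; first exact: normc_ge_Re.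
  (* The imaginary part of [z] is minus the real part of i z, which has the same modulus. *)
  have := normc_ge_Re (z * 'i%C); rewrite normrM; case: z => u v /=.
  rewrite !mulr0 mulr1 sub0r normrN => /le_trans; apply.
  by rewrite [X in _ * X]normc_def /= expr0n expr1n add0r sqrtr1 mulr1.
have reals : complex.Re (f x i j) = complex.Re (f y i j)
    /\ complex.Im (f x i j) = complex.Im (f y i j).
  split; move: xI yI; move: x y;
    [apply: (@zero_derivative_cst R I (fun w => complex.Re (f w i j)))
    |apply: (@zero_derivative_cst R I (fun w => complex.Im (f w i j)))];
  move=> z zI; apply/cvgr0Pnorm_lt => e e0;
  have /cvgr0Pnorm_lt/(_ e%:C) := df z zI; rewrite ltcR => /(_ e0);
  apply: filterS => w; rewrite /GRing.scale /= quotE => /norm_lt[] /=.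
  - by case: (f w i j) (f z i j) => [? ?] [? ?].
  - by case: (f w i j) (f z i j) => [? ?] [? ?].
by case: reals; case: (f x i j) (f y i j) => [? ?] [? ?] /= -> ->.
Qed.

(** * Differentiability of the linear system and of the transformed coefficients *)

Definition derivable_in (R : realType) (V : normedModType R[i]) (I : interval R)
    (f : R -> V) (x : R) : Prop := exists f', is_derivative_in I f x f'.

Section DerivableIn.
Variables (R : realType) (I : interval R) (x : R).
Local Notation C := (R[i]).

Lemma is_derivative_in_big_nat (V : normedModType C) a b (f : nat -> R -> V) f' :
  (forall i, (a <= i < b)%N -> is_derivative_in I (f i) x (f' i)) ->
  is_derivative_in I (fun y => \sum_(a <= i < b) f i y) x (\sum_(a <= i < b) f' i).
Proof.
move=> df; rewrite big_nat; under eq_fun do rewrite big_nat.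
exact: is_derivative_in_sum.
Qed.

Lemma derivable_in_cst (V : normedModType C) (a : V) : derivable_in I (fun=> a) x.
Proof. by exists 0; apply: is_derivative_in_cst. Qed.

Lemma derivable_inD (V : normedModType C) (f g : R -> V) :
  derivable_in I f x -> derivable_in I g x -> derivable_in I (fun y => f y + g y) x.
Proof. by move=> [a da] [b db]; exists (a + b); apply: is_derivative_inD. Qed.

Lemma derivable_inN (V : normedModType C) (f : R -> V) :
  derivable_in I f x -> derivable_in I (fun y => - f y) x.
Proof. by move=> [a da]; exists (- a); apply: is_derivative_inN. Qed.

Lemma derivable_inB (V : normedModType C) (f g : R -> V) :
  derivable_in I f x -> derivable_in I g x -> derivable_in I (fun y => f y - g y) x.
Proof. by move=> df dg; apply: derivable_inD => //; apply: derivable_inN. Qed.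

Lemma derivable_in_mulmx (m n p : nat) (f : R -> 'M[C]_(m, n)) (g : R -> 'M[C]_(n, p)) :
  derivable_in I f x -> derivable_in I g x -> derivable_in I (fun y => f y *m g y) x.
Proof.
by move=> [a da] [b db]; exists (a *m g x + f x *m b); apply: is_derivative_in_mulmx.
Qed.

Lemma derivable_in_invmx (n : nat) (S : R -> 'M[C]_n.+1) : S x \in unitmx ->
  derivable_in I S x -> derivable_in I (fun y => (S y)^-1) x.
Proof.
by move=> uS [a da]; eexists; apply: is_derivative_in_invmx uS da.
Qed.

Lemma derivable_in_big_nat (V : normedModType C) a b (f : nat -> R -> V) :
  (forall i, (a <= i < b)%N -> derivable_in I (f i) x) ->
  derivable_in I (fun y => \sum_(a <= i < b) f i y) x.
Proof.
move=> df.
have /choice[f' df'] : forall i, exists f',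
    (a <= i < b)%N -> is_derivative_in I (f i) x f'.
  move=> i; have [ab|ab] := boolP (a <= i < b)%N; last by exists 0 => abi; case/negP: ab.
  by have [f' ?] := df i ab; exists f'.
by exists (\sum_(a <= i < b) f' i); apply: is_derivative_in_big_nat.
Qed.

Lemma derivable_in_sum (V : normedModType C) (J : Type) (s : seq J) (f : J -> R -> V) :
  (forall i, derivable_in I (f i) x) ->
  derivable_in I (fun y => \sum_(i <- s) f i y) x.
Proof.
move=> /choice[f' df']; exists (\sum_(i <- s) f' i).
by apply: is_derivative_in_sum => i _; apply: df'.
Qed.

Section Coefficients.
Variables (m n r l : nat) (rs : 'I_l -> nat) (c : 'I_l -> C).
Variables (q : nat -> R -> 'M[C]_m) (qs : 'I_l -> nat -> R -> 'M[C]_m).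
Variables (A1 A2 : 'M[C]_n.+1).
Variables (P1 : R -> 'M[C]_(n.+1, m)) (P2s : R -> 'M[C]_(m, n.+1)).
Hypothesis dq : forall k, (k < r.+1)%N -> derivable_in I (q k) x.
Hypothesis dqs : forall s k, (0 < k <= rs s)%N -> derivable_in I (qs s k) x.
Hypothesis dP1 : derivable_in I P1 x.
Hypothesis dP2s : derivable_in I P2s x.

(** Differentiation directed by syntax. Constant subterms, including all powers of [A1], [A2] and
    their shifts, are caught by the first case; [inverse] is the tactic to run on an inverse that
    varies with [y]. *)
Ltac derive inverse := cbv beta; lazymatch goal with
  | |- derivable_in _ (fun _ => ?a) _ => apply: derivable_in_cst
  | |- derivable_in _ (fun y => mulmx (@?f y) (@?g y)) _ =>
      apply: (@derivable_in_mulmx _ _ _ f g); derive inverse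
  | |- derivable_in _ (fun y => Algebra.add (@?f y) (Algebra.opp (@?g y))) _ =>
      apply: (@derivable_inB _ f g); derive inverse
  | |- derivable_in _ (fun y => Algebra.add (@?f y) (@?g y)) _ =>
      apply: (@derivable_inD _ f g); derive inverse
  | |- derivable_in _ (fun y => Algebra.opp (@?f y)) _ =>
      apply: (@derivable_inN _ f); derive inverse
  | |- derivable_in _ (fun y => GRing.inv _) _ => inverse
  | |- derivable_in _ (fun y => P1 y) _ => exact dP1
  | |- derivable_in _ (fun y => P2s y) _ => exact dP2s
  | |- derivable_in _ (fun y => q _ y) _ => apply: dq; lia
  | |- derivable_in _ (fun y => qs _ _ y) _ => apply: dqs; lia
  | |- _ =>
      first [apply: derivable_in_big_nat => ? ? | apply: derivable_in_sum => ?];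
      derive inverse
  end.

Lemma derivable_rhs_Pi1 :
  derivable_in I (fun y => rhs_Pi1 r rs c (q^~ y) (fun s k => qs s k y) A1 (P1 y)) x.
Proof. rewrite /rhs_Pi1; derive fail. Qed.

Lemma derivable_rhs_Pi2s :
  derivable_in I (fun y => rhs_Pi2s r rs c (q^~ y) (fun s k => qs s k y) A2 (P2s y)) x.
Proof. rewrite /rhs_Pi2s; derive fail. Qed.

Lemma derivable_rhs_S : derivable_in I (fun y =>
  rhs_S r rs c (q^~ y) (fun s k => qs s k y) A1 A2 (P1 y) (P2s y)) x.
Proof. rewrite /rhs_S; derive fail. Qed.

Variable S : R -> 'M[C]_n.+1.
Hypothesis dS : derivable_in I S x.
Hypothesis uS : S x \in unitmx.

Lemma derivable_q_tilde k : (k < r.+1)%N -> derivable_in I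
  (fun y => q_tilde r (q^~ y) A1 A2 (P1 y) (P2s y) (S y) k) x.
Proof.
move=> kr; rewrite /q_tilde /X_mx /Y_mx.
derive ltac:(apply: (derivable_in_invmx uS dS)).
Qed.

Lemma derivable_qs_tilde s k : (0 < k <= rs s)%N -> derivable_in I
  (fun y => qs_tilde rs c (fun s k => qs s k y) A1 A2 (P1 y) (P2s y) (S y) s k) x.
Proof.
move=> kr; rewrite /qs_tilde /X_mx /Y_mx.
derive ltac:(apply: (derivable_in_invmx uS dS)).
Qed.

End Coefficients.
End DerivableIn.

End DerivativeCalculus.

(** * The zero curvature equation *)

Section DarbouxTransport.
Local Open Scope complex_scope.
Local Open Scope classical_set_scope.

(* This is [p2 *m S^-1 - P2s *m S^-1 *m s *m S^-1], the derivative of [P2s *m S^-1]. *)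
Definition coupling_rate (C : fieldType) (m n : nat) (P2s : 'M[C]_(m, n.+1))
    (S : 'M[C]_n.+1) (p2 : 'M[C]_(m, n.+1)) (s : 'M[C]_n.+1) : 'M[C]_(m, n.+1) :=
  (p2 - P2s *m S^-1 *m s) *m S^-1.

(** The derivative of [darboux], with those of [P1], [P2s], [S] as parameters: it is used both with
    the derivatives along [I] and with the right-hand sides of the system in the other variable. *)
Definition darboux_rate (C : fieldType) (m n : nat) (A1 S : 'M[C]_n.+1)
    (P1 : 'M[C]_(n.+1, m)) (P2s : 'M[C]_(m, n.+1)) (lam : C)
    (p1 : 'M[C]_(n.+1, m)) (p2 : 'M[C]_(m, n.+1)) (s : 'M[C]_n.+1) : 'M[C]_m :=
  - (coupling_rate P2s S p2 s *m (A1 - lam%:M)^-1 *m P1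
     + P2s *m S^-1 *m (A1 - lam%:M)^-1 *m p1).

Lemma derivable_coefficients (R : realType) (I : interval R) (x : R)
    (m r l : nat) (rs : 'I_l -> nat) (c : 'I_l -> R[i])
    (q : nat -> R -> 'M[R[i]]_m) (qs : 'I_l -> nat -> R -> 'M[R[i]]_m) :
  injective c ->
  (forall lam, (forall s, lam != c s) ->
     derivable_in I (fun y => rational_mx r rs c (q^~ y) (fun s k => qs s k y) lam) x) ->
  (forall k, (k < r.+1)%N -> derivable_in I (q k) x) /\
  (forall s k, (0 < k <= rs s)%N -> derivable_in I (qs s k) x).
Proof.
move=> cI dG.
have all_coef u0 : derivable_in I
    (fun y => @pf_coef _ r l rs (q^~ y) (fun s k => qs s k y) u0) x.
  have [N [z [b [zc coefE]]]] := rational_mx_coefficient u0 cI.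
  under eq_fun do rewrite coefE.
  apply: derivable_in_sum => i; have [g dg] := dG (z i) (zc i).
  by exists (b i *: g); apply: is_derivative_inZ.
split=> [k kr|s [//|k] /= ks]; first exact: (all_coef (inl (Ordinal kr))).
exact: (all_coef (inr (Tagged (fun s => 'I_(rs s)) (Ordinal ks)))).
Qed.

(** * Differentiating the equation for w in one variable with respect to the other *)

Section Transport.
Variables (R : realType) (I : interval R) (x : R).
Local Notation C := (R[i]).
Variables (m n r l : nat) (rs : 'I_l -> nat) (c : 'I_l -> C).
Variables (q : nat -> R -> 'M[C]_m) (qs : 'I_l -> nat -> R -> 'M[C]_m).
Variables (A1 A2 : 'M[C]_n.+1).
Variables (P1 : R -> 'M[C]_(n.+1, m)) (P2s : R -> 'M[C]_(m, n.+1)).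
Variables (S : R -> 'M[C]_n.+1).
Variables (P1' : 'M[C]_(n.+1, m)) (P2s' : 'M[C]_(m, n.+1)) (S' : 'M[C]_n.+1).
Hypothesis ndI : nondegenerate_interval I.
Hypothesis xI : x \in I.
Hypothesis cI : injective c.
Hypothesis uc1 : forall s, A1 - (c s)%:M \is a GRing.unit.
Hypothesis uc2 : forall s, A2 - (c s)%:M \is a GRing.unit.
Hypothesis dP1 : is_derivative_in I P1 x P1'.
Hypothesis dP2s : is_derivative_in I P2s x P2s'.
Hypothesis dS : is_derivative_in I S x S'.
Hypothesis uS : S x \in unitmx.
Hypothesis sylvester : forall y, y \in I -> A1 *m S y - S y *m A2 = P1 y *m P2s y.

Let G y lam := rational_mx r rs c (q^~ y) (fun s k => qs s k y) lam.
Let Gt y lam := rational_mx_tilde r rs c (q^~ y) (fun s k => qs s k y)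
  A1 A2 (P1 y) (P2s y) (S y) lam.
Let p1 y := rhs_Pi1 r rs c (q^~ y) (fun s k => qs s k y) A1 (P1 y).
Let p2 y := rhs_Pi2s r rs c (q^~ y) (fun s k => qs s k y) A2 (P2s y).
Let s y := rhs_S r rs c (q^~ y) (fun s k => qs s k y) A1 A2 (P1 y) (P2s y).
Let w y lam := darboux A1 (S y) (P1 y) (P2s y) lam.
Let dw y lam := darboux_rate A1 (S y) (P1 y) (P2s y) lam (p1 y) (p2 y) (s y).

Hypothesis dG : forall lam, (forall s, lam != c s) -> derivable_in I (G^~ lam) x.

Lemma tilde_darboux y lam : y \in I -> S y \in unitmx ->
  (forall s, lam != c s) ->
  A1 - lam%:M \in unitmx -> A2 - lam%:M \in unitmx ->
  Gt y lam *m w y lam = dw y lam + w y lam *m G y lam.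
Proof.
move=> yI uSy lamc u1 u2; rewrite /Gt rational_mx_tilde_dress //.
by rewrite /w dress_darboux ?sylvester // addrC.
Qed.

Lemma is_derivative_in_coupling :
  is_derivative_in I (fun y => P2s y *m (S y)^-1) x (coupling_rate (P2s x) (S x) P2s' S').
Proof.
rewrite /coupling_rate mulmxBl -!mulmxA -mulmxN.
by apply: is_derivative_in_mulmx dP2s _; rewrite mulmxA; apply: is_derivative_in_invmx uS dS.
Qed.

Lemma is_derivative_in_darboux lam : is_derivative_in I (w^~ lam) x
  (darboux_rate A1 (S x) (P1 x) (P2s x) lam P1' P2s' S').
Proof.
rewrite -[darboux_rate _ _ _ _ _ _ _ _]sub0r; apply: is_derivative_inB.
  exact: is_derivative_in_cst.
apply: (is_derivative_in_mulmx _ dP1).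
exact: is_derivative_in_mulmxr is_derivative_in_coupling.
Qed.

(** Here [I] is the range of t when [G] governs the x-system, and vice versa: primed quantities are
    derivatives along [I], while [p1], [p2], [s] give the derivatives in the other variable. Both
    sides of [Gt w = dw + w G] are differentiated along [I], and uniqueness of the derivative
    equates the results. [a] and [b], the derivatives of [coupling_rate] and of [p1], are chosen
    before [lam]; they contain the mixed second derivatives. *)
Lemma darboux_transport : exists (dq : nat -> 'M[C]_m) (dqs : 'I_l -> nat -> 'M[C]_m)
    (a : 'M[C]_(m, n.+1)) (b : 'M[C]_(n.+1, m)),
  (forall lam, (forall s, lam != c s) ->
     is_derivative_in I (Gt^~ lam) x (rational_mx r rs c dq dqs lam)) /\
  (forall lam Gd, (forall s, lam != c s) ->
     A1 - lam%:M \in unitmx -> A2 - lam%:M \in unitmx ->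
     is_derivative_in I (G^~ lam) x Gd ->
     let R1 : 'M[C]_n.+1 := (A1 - lam%:M)^-1 in
     let w' := darboux_rate A1 (S x) (P1 x) (P2s x) lam P1' P2s' S' in
     rational_mx r rs c dq dqs lam *m w x lam + Gt x lam *m w'
     = - (a *m R1 *m P1 x + coupling_rate (P2s x) (S x) (p2 x) (s x) *m R1 *m P1'
          + (coupling_rate (P2s x) (S x) P2s' S' *m R1 *m p1 x
             + P2s x *m (S x)^-1 *m R1 *m b))
       + (w' *m G x lam + w x lam *m Gd)).
Proof.
have [dq dqs] := derivable_coefficients cI dG.
have eP1 : derivable_in I P1 x by exists P1'.
have eP2s : derivable_in I P2s x by exists P2s'.
have eS : derivable_in I S x by exists S'.
have /choice[dqt dqtP] k : exists d, (k < r.+1)%N -> is_derivative_in I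
    (fun y => q_tilde r (q^~ y) A1 A2 (P1 y) (P2s y) (S y) k) x d.
  have [kr|] := boolP (k < r.+1)%N; last by exists 0.
  by have [d ?] := derivable_q_tilde A1 A2 dq eP1 eP2s eS uS kr; exists d.
(* Pairs [(s, k)] let one use of choice cover all polar coefficients; out of range the value is
   0. *)
have /choice[dqst' dqstP'] (sk : 'I_l * nat) : exists d,
    (0 < sk.2 <= rs sk.1)%N -> is_derivative_in I
    (fun y => qs_tilde rs c (fun s k => qs s k y) A1 A2 (P1 y) (P2s y) (S y) sk.1 sk.2) x d.
  have [kr|] := boolP (0 < sk.2 <= rs sk.1)%N; last by exists 0.
  by have [d ?] := derivable_qs_tilde c A1 A2 dqs eP1 eP2s eS uS kr; exists d.
pose dqst s k := dqst' (s, k).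
have dGt lam : (forall s, lam != c s) ->
    is_derivative_in I (Gt^~ lam) x (rational_mx r rs c dqt dqst lam).
  move=> _; rewrite /rational_mx -opprD; apply: is_derivative_inN.
  apply: is_derivative_inD.
    by apply: is_derivative_in_big_nat => k kr; apply: is_derivative_inZ; apply: dqtP.
  apply: is_derivative_in_sum => s0 _; apply: is_derivative_in_big_nat => k kr.
  by apply: is_derivative_inZ; apply: (dqstP' (s0, k)).
have [b db] := derivable_rhs_Pi1 c A1 dq dqs eP1.
have [a da] : derivable_in I (fun y => coupling_rate (P2s y) (S y) (p2 y) (s y)) x.
  have es := derivable_rhs_S c A1 A2 dq dqs eP1 eP2s.
  have ep2 := derivable_rhs_Pi2s c A2 dq dqs eP2s.
  have eV := derivable_in_invmx uS eS.
  apply: (derivable_in_mulmx _ eV); apply: (derivable_inB ep2).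
  by apply: derivable_in_mulmx es; exact: (derivable_in_mulmx eP2s eV).
exists dqt, dqst, a, b; split=> // lam Gd lamc u1 u2 dGd R1 w'.
apply: (@is_derivative_in_unique R I _ x (fun y => Gt y lam *m w y lam) _ _ ndI xI).
  exact: (is_derivative_in_mulmx (dGt lam lamc) (@is_derivative_in_darboux lam)).
apply: (@is_derivative_in_near _ _ _ _ (fun y => dw y lam + w y lam *m G y lam)).
- by rewrite tilde_darboux.
- have uSy : \forall y \near within [set` I] x^', S y \in unitmx.
    exact: near_unitmx (is_derivative_in_cvg dS) uS.
  have yI : \forall y \near within [set` I] x^', y \in I by exact: withinT.
  by apply: filterS2 yI uSy => y yI uSy; rewrite tilde_darboux.
apply: is_derivative_inD; last first.
  exact: (is_derivative_in_mulmx (@is_derivative_in_darboux lam) dGd).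
have da1 := is_derivative_in_mulmxr (M := R1) da.
have db1 := is_derivative_in_mulmxr (M := R1) is_derivative_in_coupling.
exact: (is_derivative_inN (is_derivative_inD
  (is_derivative_in_mulmx da1 dP1) (is_derivative_in_mulmx db1 db))).
Qed.
End Transport.

End DarbouxTransport.

Lemma unitmx_not_eigenvalue (F : fieldType) (n : nat) (A : 'M[F]_n.+1) (a : F) :
  (A - a%:M \in unitmx) = ~~ eigenvalue A a.
Proof. by rewrite /eigenvalue negbK kermx_eq0 row_free_unit. Qed.

Lemma sylvester_invariant (R : realType) (I : interval R) (m n r l : nat)
    (rs : 'I_l -> nat) (c : 'I_l -> R[i]) (q : nat -> R -> 'M[R[i]]_m)
    (qs : 'I_l -> nat -> R -> 'M[R[i]]_m) (A1 A2 : 'M[R[i]]_n.+1)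
    (P1 : R -> 'M[R[i]]_(n.+1, m)) (P2s : R -> 'M[R[i]]_(m, n.+1))
    (S : R -> 'M[R[i]]_n.+1) :
  (forall s, A1 - (c s)%:M \is a GRing.unit) ->
  (forall s, A2 - (c s)%:M \is a GRing.unit) ->
  (forall x, x \in I ->
     [/\ is_derivative_in I P1 x
           (rhs_Pi1 r rs c (q^~ x) (fun s k => qs s k x) A1 (P1 x)),
         is_derivative_in I P2s x
           (rhs_Pi2s r rs c (q^~ x) (fun s k => qs s k x) A2 (P2s x)) &
         is_derivative_in I S x
           (rhs_S r rs c (q^~ x) (fun s k => qs s k x) A1 A2 (P1 x) (P2s x))]) ->
  {in I &, forall x y, A1 *m S x - S x *m A2 = P1 x *m P2s x ->
                       A1 *m S y - S y *m A2 = P1 y *m P2s y}.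
Proof.
move=> u1 u2 dS x y xI yI /eqP; rewrite -subr_eq0 => /eqP defect0.
apply/eqP; rewrite -subr_eq0 -defect0; apply/eqP.
pose defect z := A1 *m S z - S z *m A2 - P1 z *m P2s z.
apply: (@is_derivative_in0_cst R I _ _ defect) yI xI => z zI.
have [dP1 dP2s dSz] := dS z zI.
have dD := is_derivative_inB (is_derivative_inB (is_derivative_in_mulmxl (M := A1) dSz)
  (is_derivative_in_mulmxr (M := A2) dSz)) (is_derivative_in_mulmx dP1 dP2s).
have rhsE := @rhs_sylvester _ m n r l rs c (q^~ z) (fun s k => qs s k z)
  A1 A2 (P1 z) (P2s z) u1 u2.
by move/eqP: rhsE; rewrite -subr_eq0 => /eqP <-.
Qed.

Lemma resolvent_rational_eq0 (C : numClosedFieldType) (m n N : nat) (e : 'I_N -> C)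
    (A1 A2 : 'M[C]_n.+1) (k : int) (E : C -> 'M[C]_m)
    (K1 K2 K3 : 'M[C]_(m, n.+1)) (M1 M2 M3 : 'M[C]_(n.+1, m)) :
  (forall s, A1 - (e s)%:M \in unitmx) -> (forall s, A2 - (e s)%:M \in unitmx) ->
  rational_mx_order (fun lam => exists s, lam = e s) k E ->
  (forall lam, (forall s, lam != e s) ->
     A1 - lam%:M \in unitmx -> A2 - lam%:M \in unitmx ->
     E lam = (K1 *m (A1 - lam%:M)^-1 *m M1 + K2 *m (A1 - lam%:M)^-1 *m M2)
             *m (1%:M + K3 *m (A2 - lam%:M)^-1 *m M3)) ->
  forall lam, (forall s, lam != e s) -> E lam = 0.
Proof.
move=> u1 u2 Ek EE lam lame; apply/matrixP => i j; rewrite [RHS]mxE.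
pose Z mu := exists s, mu = e s.
pose W mu := A1 - mu%:M \isn't a GRing.unit \/ A2 - mu%:M \isn't a GRing.unit.
have off_Z mu : ~ Z mu -> forall s, mu != e s.
  by move=> Zmu s; apply/eqP => mue; apply: Zmu; exists s.
have res A : (forall mu, A - mu%:M \isn't a GRing.unit -> W mu) ->
    rational_mx_order W 1 (fun mu => (A - mu%:M)^-1).
  by move=> AW k1 k2; apply: rational_orderS (rational_mx_order_resolvent A k1 k2).
have res1 : rational_mx_order W 1 (fun mu => (A1 - mu%:M)^-1) by apply: res => mu; left.
have res2 : rational_mx_order W 1 (fun mu => (A2 - mu%:M)^-1) by apply: res => mu; right.
have sandwich p (K : 'M[C]_(m, n.+1)) (M : 'M[C]_(n.+1, p)) (Rs : C -> 'M[C]_n.+1) :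
    rational_mx_order W 1 Rs -> rational_mx_order W 1 (fun mu => K *m Rs mu *m M).
  move=> R1; rewrite -[1]addr0 -[1]add0r.
  apply: rational_mx_orderM; last exact: rational_mx_order_cst.
  by apply: rational_mx_orderM => //; exact: rational_mx_order_cst.
have order' : rational_mx_order W 1 (fun mu =>
    (K1 *m (A1 - mu%:M)^-1 *m M1 + K2 *m (A1 - mu%:M)^-1 *m M2)
    *m (1%:M + K3 *m (A2 - mu%:M)^-1 *m M3)).
  rewrite -[1]addr0; apply: rational_mx_orderM.
    by apply: rational_mx_orderD; apply: sandwich.
  apply: rational_mx_orderD; first exact: rational_mx_order_cst.
  by apply: (@rational_mx_orderW _ _ 1) => //; apply: sandwich.
apply: (@rational_liouville C Z W k _ _ (\prod_s ('X - (e s)%:P))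
   (char_poly A1 * char_poly A2) _ _ _ _ (Ek i j) (order' i j)).
- by apply/prodf_neq0 => s _; rewrite polyXsubC_eq0.
- move=> mu [s ->]; rewrite rootE horner_prod (bigD1 s) //= hornerXsubC subrr.
  by rewrite mul0r.
- by rewrite mulf_neq0 // monic_neq0 // char_poly_monic.
- have nonunit_root (A : 'M[C]_n.+1) mu : A - mu%:M \isn't a GRing.unit -> root (char_poly A) mu.
    have <- := eigenvalue_root_char A mu.
    by apply: contraR; rewrite -unitmx_not_eigenvalue.
  by move=> mu [/nonunit_root|/nonunit_root] A_root; rewrite rootM A_root ?orbT.
- by move=> _ [s ->] [/negP|/negP]; apply; [apply: u1|apply: u2].
- move=> mu Zmu Wmu; rewrite EE //; first exact: off_Z.
    by apply: contrapT => /negP h; apply: Wmu; left.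
  by apply: contrapT => /negP h; apply: Wmu; right.
by move=> [s lams]; have := lame s; rewrite lams eqxx.
Qed.

Lemma rational_mx_order_tilde (C : fieldType) (W : C -> Prop) (m n r l : nat)
    (rs : 'I_l -> nat) (c : 'I_l -> C) (q : nat -> 'M[C]_m) (qs : 'I_l -> nat -> 'M[C]_m)
    (A1 A2 : 'M[C]_n.+1) P1 P2s S :
  (forall s, W (c s)) ->
  exists k, rational_mx_order W k (rational_mx_tilde r rs c q qs A1 A2 P1 P2s S).
Proof.
move=> Wc; suff -> : rational_mx_tilde r rs c q qs A1 A2 P1 P2s S = rational_mx r rs c
    (q_tilde r q A1 A2 P1 P2s S) (qs_tilde rs c qs A1 A2 P1 P2s S).
  exact: rational_mx_order_rational.
by apply/funext => lam; rewrite /rational_mx_tilde opprD.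
Qed.

(* Adding the two derivative identities of the Darboux matrix [w], all terms
   which are not mixed second derivatives cancel. *)
Lemma curvature_darboux (C : fieldType) (m : nat)
    (Gt Ft dGt dFt G F dG dF w wx wt Mx Mt : 'M[C]_m) :
  Gt *m w = wx + w *m G -> Ft *m w = wt + w *m F ->
  dGt *m w + Gt *m wt = Mt + (wt *m G + w *m dG) ->
  dFt *m w + Ft *m wx = Mx + (wx *m F + w *m dF) ->
  dG - dF + commutator G F = 0 ->
  (dGt - dFt + commutator Gt Ft) *m w = Mt - Mx.
Proof.
move=> eG eF edG edF zc.
have eGF : Gt *m Ft *m w = Gt *m wt + wx *m F + w *m G *m F.
  by rewrite -mulmxA eF mulmxDr mulmxA eG mulmxDl addrA.
have eFG : Ft *m Gt *m w = Ft *m wx + wt *m G + w *m F *m G.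
  by rewrite -mulmxA eG mulmxDr mulmxA eF mulmxDl addrA.
have edG' : dGt *m w = Mt + (wt *m G + w *m dG) - Gt *m wt by rewrite -edG addrK.
have edF' : dFt *m w = Mx + (wx *m F + w *m dF) - Ft *m wx by rewrite -edF addrK.
have := congr1 (mulmx w) zc; rewrite mulmx0 /commutator mulmxDr !mulmxBr !mulmxA => zcw.
rewrite mulmxDl !mulmxBl edG' edF' eGF eFG.
transitivity (Mt - Mx + (w *m dG - w *m dF + (w *m G *m F - w *m F *m G))).
  by mx_linear.
by rewrite zcw addr0.
Qed.

(** The products of first derivatives occur in both second derivatives of w and cancel; only the
    differences of the second-order data remain. *)
Lemma curvature_source (C : fieldType) (m n : nat) (K K' Ct Cx U : 'M[C]_(m, n))
    (R1 : 'M[C]_n) (P1 pt px M M' : 'M[C]_(n, m)) :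
  - (K *m R1 *m P1 + Cx *m R1 *m pt + (Ct *m R1 *m px + U *m R1 *m M))
  - - (K' *m R1 *m P1 + Ct *m R1 *m px + (Cx *m R1 *m pt + U *m R1 *m M'))
  = (K' - K) *m R1 *m P1 + U *m R1 *m (M' - M).
Proof. by rewrite !mulmxBl mulmxBr; mx_linear. Qed.

Local Open Scope sesquilinear_scope.

Theorem theorem3p7 (R : realType) (m n : nat)
    (I1 I2 : interval R)
    (hI1 : nondegenerate_interval I1) (hI2 : nondegenerate_interval I2)
    (h01 : 0 \in I1) (h02 : 0 \in I2)
    (* coefficients, orders and poles of G *)
    (r l : nat) (rs : 'I_l -> nat) (c : 'I_l -> R[i])
    (q : nat -> R -> R -> 'M[R[i]]_m)
    (qs : 'I_l -> nat -> R -> R -> 'M[R[i]]_m)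
    (hc : injective c)
    (* coefficients, orders and poles of F *)
    (r' l' : nat) (rs' : 'I_l' -> nat) (c' : 'I_l' -> R[i])
    (Q : nat -> R -> R -> 'M[R[i]]_m)
    (Qs : 'I_l' -> nat -> R -> R -> 'M[R[i]]_m)
    (hc' : injective c')
    (A1 A2 : 'M[R[i]]_n.+1)
    (Pi1 Pi2 : R -> R -> 'M[R[i]]_(n.+1, m))
    (S : R -> R -> 'M[R[i]]_n.+1) :
  let G x t lam := rational_mx r rs c (fun k => q k x t)
                     (fun s k => qs s k x t) lam in
  let F x t lam := rational_mx r' rs' c' (fun k => Q k x t)
                     (fun s k => Qs s k x t) lam in
  let Gtilde x t lam := rational_mx_tilde r rs c (fun k => q k x t)
                          (fun s k => qs s k x t)
                          A1 A2 (Pi1 x t) ((Pi2 x t)^t*) (S x t) lam in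
  let Ftilde x t lam := rational_mx_tilde r' rs' c' (fun k => Q k x t)
                          (fun s k => Qs s k x t)
                          A1 A2 (Pi1 x t) ((Pi2 x t)^t*) (S x t) lam in
  (forall lam, (forall s, lam != c s) ->
     continuously_differentiable_on I1 I2 (fun x t => G x t lam)) ->
  (forall lam, (forall s, lam != c' s) ->
     continuously_differentiable_on I1 I2 (fun x t => F x t lam)) ->
  (forall x t lam, x \in I1 -> t \in I2 ->
     (forall s, lam != c s) -> (forall s, lam != c' s) ->
     zero_curvature_at I1 I2 G F x t lam) ->
  A1 *m S 0 0 - S 0 0 *m A2 = Pi1 0 0 *m (Pi2 0 0)^t* ->
  (forall s, ~~ eigenvalue A1 (c s) /\ ~~ eigenvalue A2 (c s)) ->
  (forall s, ~~ eigenvalue A1 (c' s) /\ ~~ eigenvalue A2 (c' s)) ->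
  (forall x t, x \in I1 -> t \in I2 ->
     [/\ is_derivative_in I1 (fun x' => Pi1 x' t) x
           (rhs_Pi1 r rs c (fun k => q k x t) (fun s k => qs s k x t)
              A1 (Pi1 x t)),
         is_derivative_in I1 (fun x' => (Pi2 x' t)^t*) x
           (rhs_Pi2s r rs c (fun k => q k x t) (fun s k => qs s k x t)
              A2 ((Pi2 x t)^t*)) &
         is_derivative_in I1 (fun x' => S x' t) x
           (rhs_S r rs c (fun k => q k x t) (fun s k => qs s k x t)
              A1 A2 (Pi1 x t) ((Pi2 x t)^t*))]) ->
  (forall x t, x \in I1 -> t \in I2 ->
     [/\ is_derivative_in I2 (fun t' => Pi1 x t') t
           (rhs_Pi1 r' rs' c' (fun k => Q k x t) (fun s k => Qs s k x t)
              A1 (Pi1 x t)),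
         is_derivative_in I2 (fun t' => (Pi2 x t')^t*) t
           (rhs_Pi2s r' rs' c' (fun k => Q k x t) (fun s k => Qs s k x t)
              A2 ((Pi2 x t)^t*)) &
         is_derivative_in I2 (fun t' => S x t') t
           (rhs_S r' rs' c' (fun k => Q k x t) (fun s k => Qs s k x t)
              A1 A2 (Pi1 x t) ((Pi2 x t)^t*))]) ->
  forall x t lam, x \in I1 -> t \in I2 -> S x t \in unitmx ->
    (forall s, lam != c s) -> (forall s, lam != c' s) ->
    zero_curvature_at I1 I2 Gtilde Ftilde x t lam.
Proof.
move=> G F Gtilde Ftilde dG dF zc S00 ec ec' dx dt x t lam xI tI uS lamc lamc'.
have uc1 s : A1 - (c s)%:M \in unitmx by rewrite unitmx_not_eigenvalue; case: (ec s).
have uc2 s : A2 - (c s)%:M \in unitmx by rewrite unitmx_not_eigenvalue; case: (ec s).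
have uC1 s : A1 - (c' s)%:M \in unitmx by rewrite unitmx_not_eigenvalue; case: (ec' s).
have uC2 s : A2 - (c' s)%:M \in unitmx by rewrite unitmx_not_eigenvalue; case: (ec' s).
pose P2s y z := (Pi2 y z)^t*.
have syl y z : y \in I1 -> z \in I2 ->
    A1 *m S y z - S y z *m A2 = Pi1 y z *m P2s y z.
  move=> yI zI.
  (* The identity is carried from the origin along t = 0, then along the line of constant first
     coordinate [y]. *)
  have syl0 : A1 *m S y 0 - S y 0 *m A2 = Pi1 y 0 *m P2s y 0.
    apply: (@sylvester_invariant R I1 m n r l rs c (fun k y => q k y 0)
      (fun s k y => qs s k y 0) A1 A2 (Pi1^~ 0) (P2s^~ 0) (S^~ 0) uc1 uc2 _
      0 y h01 yI S00) => y' y'I; exact: dx.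
  apply: (@sylvester_invariant R I2 m n r' l' rs' c' (fun k => Q k y)
      (fun s k => Qs s k y) A1 A2 (Pi1 y) (P2s y) (S y) uC1 uC2 _
      0 z h02 zI syl0) => z' z'I; exact: dt.
have [dP1x dP2x dSx] := dx x t xI tI; have [dP1t dP2t dSt] := dt x t xI tI.
have dGt mu : (forall s, mu != c s) -> derivable_in I2 (fun z => G x z mu) t.
  by move=> /dG[gx [gt [_ dgt _ _]]]; exists (gt x t); apply: dgt.
have dFx mu : (forall s, mu != c' s) -> derivable_in I1 (fun y => F y t mu) x.
  by move=> /dF[fx [ft [dfx _ _ _]]]; exists (fx x t); apply: dfx.
(* The equation attached to [G] describes w_x, so it is differentiated in t at fixed [x]; the one
   attached to [F] is differentiated in x at fixed [t]. *)
have [dq [dqs [a [b [dGtilde transG]]]]] := @darboux_transport R I2 t m n r l rs c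
  (fun k => q k x) (fun s k => qs s k x) A1 A2 (Pi1 x) (P2s x) (S x) _ _ _
  hI2 tI hc uc1 uc2 dP1t dP2t dSt uS (fun z => @syl x z xI) dGt.
have [dQ [dQs [a' [b' [dFtilde transF]]]]] := @darboux_transport R I1 x m n r' l' rs' c'
  (fun k y => Q k y t) (fun s k y => Qs s k y t) A1 A2 (Pi1^~ t) (P2s^~ t) (S^~ t) _ _ _
  hI1 xI hc' uC1 uC2 dP1x dP2x dSx uS (fun y yI => @syl y t yI tI) dFx.
exists (rational_mx r rs c dq dqs lam), (rational_mx r' rs' c' dQ dQs lam).
split; [exact: dGtilde|exact: dFtilde|].
pose E mu := rational_mx r rs c dq dqs mu - rational_mx r' rs' c' dQ dQs mu
  + commutator (Gtilde x t mu) (Ftilde x t mu).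
(* One family lists the poles of both functions, so a point c_s may coincide with a point C_s. *)
pose e (u : 'I_(l + l')) := match fintype.split u with inl s => c s | inr s => c' s end.
have off_e mu : (forall u, mu != e u) ->
    (forall s, mu != c s) /\ (forall s, mu != c' s).
  move=> mue; split=> s; [have := mue (unsplit (inl s))|have := mue (unsplit (inr s))];
  by rewrite /e unsplitK.
have off_eI s : lam != e s by rewrite /e; case: fintype.split => u; [exact: lamc|exact: lamc'].
have [k Ek] : exists k, rational_mx_order (fun mu => exists s, mu = e s) k E.
  pose Z mu := exists s, mu = e s.
  have Zc s : Z (c s) by exists (unsplit (inl s)); rewrite /e unsplitK.
  have Zc' s : Z (c' s) by exists (unsplit (inr s)); rewrite /e unsplitK.
  have [k1 o1] := rational_mx_order_rational (W := Z) r rs dq dqs Zc.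
  have [k2 o2] := rational_mx_order_rational (W := Z) r' rs' dQ dQs Zc'.
  have [k3 o3] := rational_mx_order_tilde (W := Z) r rs (fun k => q k x t) (fun s k => qs s k x t)
    A1 A2 (Pi1 x t) (P2s x t) (S x t) Zc.
  have [k4 o4] := rational_mx_order_tilde (W := Z) r' rs' (fun k => Q k x t)
    (fun s k => Qs s k x t) A1 A2 (Pi1 x t) (P2s x t) (S x t) Zc'.
  pose k := Order.min (Order.min k1 k2) (k3 + k4).
  have kk1 : k <= k1 by rewrite /k !ge_min lexx.
  have kk2 : k <= k2 by rewrite /k !ge_min lexx orbT.
  have kk34 : k <= k3 + k4 by rewrite /k !ge_min lexx !orbT.
  have kk43 : k <= k4 + k3 by rewrite addrC.
  exists k; apply: rational_mx_orderD; apply: rational_mx_orderD.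
  - exact: rational_mx_orderW kk1 o1.
  - by apply: rational_mx_orderN; exact: rational_mx_orderW kk2 o2.
  - exact: rational_mx_orderW kk34 (rational_mx_orderM o3 o4).
  - by apply: rational_mx_orderN; exact: rational_mx_orderW kk43 (rational_mx_orderM o4 o3).
apply: (@resolvent_rational_eq0 _ m n _ e A1 A2 k E (a' - a)
  (P2s x t *m (S x t)^-1) (P2s x t) (Pi1 x t) (b' - b) ((S x t)^-1 *m Pi1 x t)
  _ _ Ek) => [s|s|mu mue u1 u2|s].
- by rewrite /e; case: fintype.split => u; [exact: uc1|exact: uC1].
- by rewrite /e; case: fintype.split => u; [exact: uc2|exact: uC2].
- have [muc muc'] := off_e mu mue.
  have [Gd [Fd [dGd dFd zcmu]]] := zc x t mu xI tI muc muc'.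
  have eG := @tilde_darboux R I2 m n r l rs c (fun k => q k x) (fun s k => qs s k x)
    A1 A2 (Pi1 x) (P2s x) (S x) uc1 uc2 (fun z => @syl x z xI) t mu tI uS muc u1 u2.
  have eF := @tilde_darboux R I1 m n r' l' rs' c' (fun k y => Q k y t)
    (fun s k y => Qs s k y t) A1 A2 (Pi1^~ t) (P2s^~ t) (S^~ t) uC1 uC2
    (fun y yI => @syl y t yI tI) x mu xI uS muc' u1 u2.
  have EwE := curvature_darboux eG eF (transG mu Gd muc u1 u2 dGd)
    (transF mu Fd muc' u1 u2 dFd) zcmu.
  (* Inserting w w^-1 on the right of [E] brings in the product E w computed in [EwE]. *)
  rewrite -[LHS]mulmx1 -[in LHS](darbouxK (syl x t xI tI) uS u1 u2) mulmxA.
  rewrite [X in X *m _]EwE; congr (_ *m _); exact: curvature_source.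
- exact: off_eI.
Qed.
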